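(* Let $M_1,M_2$ be smooth manifolds with $m_2=\dim M_2\ge 2$, and let $\bar g(x,y,t)=g_1(x,t)\oplus\lambda^2(x,t)g_2(y)$ be a smooth family of warped product metrics on $M_1\times M_2$ evolving by the Ricci flow $\frac{\partial}{\partial t}\bar g=-2\,\overline{\mathrm{Ric}}$, where $g_2$ is a fixed Einstein metric with ${}^{M_2}\mathrm{Ric}=c\,g_2$, $c$ a constant. Then the Ricci curvature components $\overline{\mathrm{Ric}}_{\alpha\beta}$ satisfy the evolution equation $$\begin{aligned} \frac{\partial}{\partial t}\overline{\mathrm{Ric}}_{\alpha\beta}&=\bar\Delta\overline{\mathrm{Ric}}_{\alpha\beta}-\frac{2}{m_2}\bar g^{kp}\big(\overline{\mathrm{Ric}}_{kp}-{}^{M_1}\mathrm{Ric}_{kp}\big)\overline{\mathrm{Ric}}_{\alpha\beta}\\ &\quad+\frac{2}{m_2}\bar g^{kl}\bar g^{pq}\big(\overline{\mathrm{Ric}}_{kp}-{}^{M_1}\mathrm{Ric}_{kp}\big)\overline{\mathrm{Ric}}_{lq}\,\bar g_{\alpha\beta}. \end{aligned}$$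
   Context: Here $g_1(\cdot,t)$ is a family of Riemannian metrics on $M_1$, $g_2$ is a Riemannian metric on $M_2$ independent of $t$, $\lambda(x,t)>0$ is a smooth function of $x\in M_1$ and $t$, and $\bar g(t)=\pi_1^*g_1(t)+(\lambda(\cdot,t)\circ\pi_1)^2\pi_2^*g_2$, with $\pi_i$ the projections; $\overline{\mathrm{Ric}}$ is the Ricci tensor of $\bar g(t)$. Latin indices $k,l,p,q$ run over local coordinates $x^i$ on $M_1$, and Greek indices over local coordinates $y^\alpha$ on $M_2$; repeated indices are summed. $\bar g_{ij}=\bar g((\partial_i,0),(\partial_j,0))=(g_1)_{ij}$, $\bar g_{\alpha\beta}=\bar g((0,\partial_\alpha),(0,\partial_\beta))=\lambda^2(g_2)_{\alpha\beta}$, and $\bar g^{ij}$ are the corresponding components of the inverse of $\bar g$ (mixed components vanish). $\overline{\mathrm{Ric}}_{ij}=\overline{\mathrm{Ric}}((\partial_i,0),(\partial_j,0))$, $\overline{\mathrm{Ric}}_{\alpha\beta}=\overline{\mathrm{Ric}}((0,\partial_\alpha),(0,\partial_\beta))$. $\bar\Delta\overline{\mathrm{Ric}}_{\alpha\beta}$ denotes the components of the (rough) Laplacian, with respect to $\bar g(t)$, of the tensor $\overline{\mathrm{Ric}}$. ${}^{M_1}\mathrm{Ric}$ is the Ricci tensor of $g_1(t)$. *)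

(* Defs.v *)
From HB Require Import structures.
From mathcomp Require Import all_boot all_order all_algebra.
From mathcomp Require Import all_classical all_reals all_analysis.

Set Implicit Arguments.
Unset Strict Implicit.
Unset Printing Implicit Defensive.

Import Order.TTheory GRing.Theory Num.Theory.
Import numFieldNormedType.Exports.

Local Open Scope classical_set_scope.
Local Open Scope ring_scope.

Section Smoothness.
Context {R : realType}.

(* On finite-dimensional [V], asking for all directional derivatives amounts *)
(* to asking for the partial derivatives.                                    *)
Fixpoint Ck {V W : normedModType R} (k : nat) (U : set V) (f : V -> W) : Prop :=
  (forall x, U x -> {for x, continuous f}) /\
  (if k is k'.+1 then
     forall v : V, (forall x, U x -> derivable f x v) /\ Ck k' U ('D_v f)
   else True).

(* [A] need not be open: [f] is smooth on [A] when it extends, near each     *)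
(* point of [A], to a smooth function on an open set.                        *)
Definition smooth_on {V W : normedModType R} (A : set V) (f : V -> W) : Prop :=
  forall a, A a -> exists (U : set V) (F : V -> W),
    [/\ open U, U a, (forall k, Ck k U F) & forall x, U x -> A x -> F x = f x].

(* [l] is the derivative at [t] of [f] restricted to [J] (one-sided at an    *)
(* endpoint of [J]).                                                         *)
Definition has_derivative_within (J : set R) (f : R -> R) (t l : R) : Prop :=
  (f s - f t) / (s - t) @[s --> within J t^'] --> l.

End Smoothness.

Section TensorCalculus.
Context {R : realType} {n : nat}.
Implicit Types (g T : 'rV[R]_n -> 'M[R]_n) (x : 'rV[R]_n) (i j k l : 'I_n).

Definition partial k (f : 'rV[R]_n -> R) x : R := 'D_(delta_mx 0 k) f x.

Definition inv_metric g x k l : R := invmx (g x) k l.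

(* [christoffel g k i j] is Gamma^k_ij. *)
Definition christoffel g k i j x : R :=
  2^-1 * \sum_l inv_metric g x k l *
    (partial i (fun y => g y j l) x + partial j (fun y => g y i l) x
     - partial l (fun y => g y i j) x).

(* [riemann g i j k l] is R_ijk^l, where                                     *)
(* R(d_i, d_j) d_k = nabla_i nabla_j d_k - nabla_j nabla_i d_k = R_ijk^l d_l *)
Definition riemann g i j k l x : R :=
  partial i (christoffel g l j k) x - partial j (christoffel g l i k) x
  + \sum_m (christoffel g l i m x * christoffel g m j k x
            - christoffel g l j m x * christoffel g m i k x).

Definition ricci_mx g x : 'M[R]_n := \matrix_(j, k) \sum_i riemann g i j k i x.

(* [cov_deriv g T k i j] is (nabla T)(d_k; d_i, d_j). *)
Definition cov_deriv g T k i j x : R :=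
  partial k (fun y => T y i j) x
  - \sum_m (christoffel g m k i x * T x m j + christoffel g m k j x * T x i m).

(* [cov_deriv2 g T k l i j] is (nabla (nabla T))(d_k; d_l, d_i, d_j). *)
Definition cov_deriv2 g T k l i j x : R :=
  partial k (cov_deriv g T l i j) x
  - \sum_m (christoffel g m k l x * cov_deriv g T m i j x
            + christoffel g m k i x * cov_deriv g T l m j x
            + christoffel g m k j x * cov_deriv g T l i m x).

Definition laplacian_mx g T x : 'M[R]_n :=
  \matrix_(i, j) \sum_k \sum_l inv_metric g x k l * cov_deriv2 g T k l i j x.

End TensorCalculus.

(* [from_coord c] is a total function whose values off the image of the      *)
(* chart [c] are irrelevant.                                                 *)
Record manifold (R : realType) (n : nat) := Manifold {
  point :> topologicalType;
  manifold_hausdorff : hausdorff_space point;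
  manifold_second_countable : second_countable (T := point);
  chart : Type;
  chart_dom : chart -> set point;
  coord : chart -> point -> 'rV[R]_n;
  from_coord : chart -> 'rV[R]_n -> point;
  open_chart_dom : forall c, open (chart_dom c);
  open_chart_img : forall c, open (coord c @` chart_dom c);
  coord_cont : forall c p, chart_dom c p -> {for p, continuous (coord c)};
  from_coord_cont : forall c x, (coord c @` chart_dom c) x ->
    {for x, continuous (from_coord c)};
  coordK : forall c p, chart_dom c p -> from_coord c (coord c p) = p;
  chart_cover : forall p, exists c, chart_dom c p;
  transition_smooth : forall c d,
    smooth_on (coord c @` (chart_dom c `&` chart_dom d))
              (coord d \o from_coord c) }.

Definition chart_img (R : realType) n (M : manifold R n) (c : chart M) :
  set 'rV[R]_n := coord c @` chart_dom c.

Section ProductManifold.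
Context {R : realType} {m1 m2 : nat}.

Lemma cvg_row_mx {T : Type} (F : set_system T) {FF : Filter F}
    (f : T -> 'rV[R]_m1) (g : T -> 'rV[R]_m2)
    (a : 'rV[R]_m1) (b : 'rV[R]_m2) :
  f @ F --> a -> g @ F --> b ->
  (fun t => row_mx (f t) (g t)) @ F --> row_mx a b.
Proof.
move=> fa gb A [P nP sPA].
have nf : F (f @^-1` [set u | forall j, P 0 (lshift m2 j) (u 0 j)]).
  apply: fa; exists (fun i j => P i (lshift m2 j)) => [i j|u Pu j].
    by move: (nP i (lshift m2 j)); rewrite row_mxEl.
  exact: Pu.
have ng : F (g @^-1` [set u | forall j, P 0 (rshift m1 j) (u 0 j)]).
  apply: gb; exists (fun i j => P i (rshift m1 j)) => [i j|u Pu j].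
    by move: (nP i (rshift m1 j)); rewrite row_mxEr.
  exact: Pu.
suff : F [set t | A (row_mx (f t) (g t))] by [].
apply: filterS (filterI nf ng) => t [/= Pf Pg]; apply: sPA => i j.
rewrite ord1; case: (split_ordP j) => k ->.
  by rewrite row_mxEl; exact: Pf.
by rewrite row_mxEr; exact: Pg.
Qed.

Lemma cvg_comp_at {S T U : topologicalType} (f : S -> T) (g : T -> U) x :
  {for x, continuous f} -> {for f x, continuous g} ->
  (fun y => g (f y)) @ x --> g (f x).
Proof. exact: continuous_comp. Qed.

Lemma Ck_ext {V W : normedModType R} k (U : set V) (f g : V -> W) :
  open U -> (forall x, U x -> f x = g x) -> Ck k U f -> Ck k U g.
Proof.
move=> oU.
have near_fg (h1 h2 : V -> W) : (forall x, U x -> h1 x = h2 x) ->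
    forall x, U x -> \near x, h1 x = h2 x.
  by move=> fg x Ux; apply: filterS (open_nbhs_nbhs (conj oU Ux)) => y /fg.
have cont (h1 h2 : V -> W) : (forall x, U x -> h1 x = h2 x) ->
    (forall x, U x -> {for x, continuous h1}) ->
    forall x, U x -> {for x, continuous h2}.
  move=> fg c x Ux.
  have : h2 @ x --> h1 x.
    by apply: cvg_trans (c x Ux); apply: near_eq_cvg; exact: near_fg.
  by rewrite (fg _ Ux).
elim: k f g => [|k IH] f g fg [c D]; split; try exact: cont c; first by [].
move=> v; have [d Df] := D v; split=> [x Ux|].
  by apply: near_eq_derivable (d x Ux); exact: near_fg.
by apply: IH Df => x Ux; apply: near_eq_derive; exact: near_fg.
Qed.

Lemma Ck_row_mx k (U1 : set 'rV[R]_m1) (U2 : set 'rV[R]_m2)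
    (f1 : 'rV[R]_m1 -> 'rV[R]_m1) (f2 : 'rV[R]_m2 -> 'rV[R]_m2) :
  open (lsubmx @^-1` U1 `&` rsubmx @^-1` U2 : set 'rV[R]_(m1 + m2)) ->
  Ck k U1 f1 -> Ck k U2 f2 ->
  Ck k (lsubmx @^-1` U1 `&` rsubmx @^-1` U2 : set 'rV[R]_(m1 + m2))
     (fun z => row_mx (f1 (lsubmx z)) (f2 (rsubmx z))).
Proof.
move=> oU.
have cont (h1 : 'rV[R]_m1 -> 'rV[R]_m1) (h2 : 'rV[R]_m2 -> 'rV[R]_m2) z :
    {for lsubmx z, continuous h1} -> {for rsubmx z, continuous h2} ->
    {for z, continuous (fun z => row_mx (h1 (lsubmx z)) (h2 (rsubmx z)))}.
  move=> c1 c2.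
  exact: (cvg_row_mx (cvg_comp_at (@continuous_lsubmx _ _ _ _ z) c1)
                     (cvg_comp_at (@continuous_rsubmx _ _ _ _ z) c2)).
elim: k f1 f2 => [|k IH] f1 f2 [c1 D1] [c2 D2].
  by split=> // z [/= U1z U2z]; apply: cont; [exact: c1|exact: c2].
have dl v z : (lsubmx @^-1` U1 `&` rsubmx @^-1` U2) z ->
    h^-1 *: (row_mx (f1 (lsubmx (h *: v + z))) (f2 (rsubmx (h *: v + z)))
             - row_mx (f1 (lsubmx z)) (f2 (rsubmx z))) @[h --> 0^'] -->
    row_mx ('D_(lsubmx v) f1 (lsubmx z)) ('D_(rsubmx v) f2 (rsubmx z)).
  move=> [/= U1z U2z].
  have d1 : h^-1 *: (f1 (h *: lsubmx v + lsubmx z) - f1 (lsubmx z))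
      @[h --> 0^'] --> 'D_(lsubmx v) f1 (lsubmx z).
    exact: ((D1 (lsubmx v)).1 _ U1z).
  have d2 : h^-1 *: (f2 (h *: rsubmx v + rsubmx z) - f2 (rsubmx z))
      @[h --> 0^'] --> 'D_(rsubmx v) f2 (rsubmx z).
    exact: ((D2 (rsubmx v)).1 _ U2z).
  have e : (fun h : R => h^-1 *: (row_mx (f1 (lsubmx (h *: v + z)))
                                         (f2 (rsubmx (h *: v + z)))
             - row_mx (f1 (lsubmx z)) (f2 (rsubmx z)))) =
      (fun h => row_mx (h^-1 *: (f1 (h *: lsubmx v + lsubmx z) - f1 (lsubmx z)))
                  (h^-1 *: (f2 (h *: rsubmx v + rsubmx z) - f2 (rsubmx z)))).
    apply/funext => h.
    rewrite opp_row_mx add_row_mx scale_row_mx.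
    have -> : lsubmx (h *: v + z) = h *: lsubmx v + lsubmx z.
      by rewrite linearD linearZ.
    have -> : rsubmx (h *: v + z) = h *: rsubmx v + rsubmx z.
      by rewrite linearD linearZ.
    by [].
  by rewrite e; exact: (cvg_row_mx d1 d2).
split=> [z [/= U1z U2z]|v]; first by apply: cont; [exact: c1|exact: c2].
split=> [z Uz|].
  by apply: cvgP; exact: dl.
have := IH _ _ (D1 (lsubmx v)).2 (D2 (rsubmx v)).2.
apply: Ck_ext => // z Uz; apply/esym/cvg_lim; first exact: norm_hausdorff.
exact: dl.
Qed.

Lemma open_split_mx (U1 : set 'rV[R]_m1) (U2 : set 'rV[R]_m2) :
  open U1 -> open U2 ->
  open (lsubmx @^-1` U1 `&` rsubmx @^-1` U2 : set 'rV[R]_(m1 + m2)).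
Proof.
move=> o1 o2; apply: openI; apply: open_comp => // z _.
  exact: continuous_lsubmx.
exact: continuous_rsubmx.
Qed.

Lemma open_prod (T1 T2 : topologicalType) (A1 : set T1) (A2 : set T2) :
  open A1 -> open A2 -> open (A1 `*` A2).
Proof.
move=> opA1 opA2; rewrite openE => -[x1 x2] [/= A1x A2x].
by exists (A1, A2) => //; split; exact: open_nbhs_nbhs.
Qed.

Lemma hausdorff_prod (T1 T2 : topologicalType) :
  hausdorff_space T1 -> hausdorff_space T2 -> hausdorff_space (T1 * T2)%type.
Proof.
move=> h1 h2 [a1 a2] [b1 b2] ab; congr pair.
  apply: h1 => A B nA nB.
  have nA' : nbhs (a1, a2) (A `*` setT).
    by exists (A, setT) => //; split=> //; exact: filterT.
  have nB' : nbhs (b1, b2) (B `*` setT).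
    by exists (B, setT) => //; split=> //; exact: filterT.
  by have [[p1 p2] [[/= pA _] [/= pB _]]] := ab _ _ nA' nB'; exists p1.
apply: h2 => A B nA nB.
have nA' : nbhs (a1, a2) (setT `*` A).
  by exists (setT, A) => //; split=> //; exact: filterT.
have nB' : nbhs (b1, b2) (setT `*` B).
  by exists (setT, B) => //; split=> //; exact: filterT.
by have [[p1 p2] [[/= _ pA] [/= _ pB]]] := ab _ _ nA' nB'; exists p2.
Qed.

Lemma second_countable_prod (T1 T2 : topologicalType) :
  second_countable (T := T1) -> second_countable (T := T2) ->
  second_countable (T := (T1 * T2)%type).
Proof.
move=> [B1 c1 [opB1 b1]] [B2 c2 [opB2 b2]].
exists ((fun UV : set T1 * set T2 => UV.1 `*` UV.2) @` (B1 `*` B2)).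
  by apply: sub_countable (card_image_le _ _) _; exact: countableX.
split.
  by move=> _ [[U V] [/= BU BV] <-]; apply: open_prod; [exact: opB1|exact: opB2].
move=> [x1 x2] A [[P Q] [/= nP nQ] sA].
have [U [BU Ux] sU] := b1 _ _ nP.
have [V [BV Vx] sV] := b2 _ _ nQ.
exists (U `*` V); first by split; [exists (U, V)|].
by move=> [p q] [/= /sU Pp /sV Qq]; exact: sA.
Qed.

Variables (M1 : manifold R m1) (M2 : manifold R m2).

Definition prod_chart_dom (c : chart M1 * chart M2) : set (M1 * M2) :=
  chart_dom c.1 `*` chart_dom c.2.

Definition prod_coord (c : chart M1 * chart M2) (p : M1 * M2) :
  'rV[R]_(m1 + m2) := row_mx (coord c.1 p.1) (coord c.2 p.2).

Definition prod_from_coord (c : chart M1 * chart M2) (z : 'rV[R]_(m1 + m2)) :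
  M1 * M2 := (from_coord c.1 (lsubmx z), from_coord c.2 (rsubmx z)).

Lemma prod_chart_imgE c (A1 : set M1) (A2 : set M2) :
  prod_coord c @` (A1 `*` A2) =
  lsubmx @^-1` (coord c.1 @` A1) `&` rsubmx @^-1` (coord c.2 @` A2).
Proof.
apply/seteqP; split=> [_ [[p q] [/= Ap Aq] <-]|z [/= [p Ap pz] [q Aq qz]]].
  by rewrite /prod_coord; split=> /=; rewrite ?row_mxKl ?row_mxKr;
    [exists p|exists q].
by exists (p, q) => //=; rewrite /prod_coord /= pz qz hsubmxK.
Qed.

Lemma prod_open_dom c : open (prod_chart_dom c).
Proof. by apply: open_prod; exact: open_chart_dom. Qed.

Lemma prod_open_img c : open (prod_coord c @` prod_chart_dom c).
Proof.
by rewrite prod_chart_imgE; apply: open_split_mx; exact: open_chart_img.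
Qed.

Lemma prod_coord_cont c p :
  prod_chart_dom c p -> {for p, continuous (prod_coord c)}.
Proof.
case: p => p q [/= Dp Dq].
have c1 : (fun y : M1 * M2 => coord c.1 y.1) @ (p, q) --> coord c.1 p.
  by apply: (@cvg_comp_at _ _ _ fst _ (p, q)); [exact: cvg_fst|exact: coord_cont].
have c2 : (fun y : M1 * M2 => coord c.2 y.2) @ (p, q) --> coord c.2 q.
  by apply: (@cvg_comp_at _ _ _ snd _ (p, q)); [exact: cvg_snd|exact: coord_cont].
exact: (cvg_row_mx c1 c2).
Qed.

Lemma prod_from_coord_cont c z : (prod_coord c @` prod_chart_dom c) z ->
  {for z, continuous (prod_from_coord c)}.
Proof.
rewrite prod_chart_imgE => -[/= z1 z2].
exact: (cvg_pair
  (cvg_comp_at (@continuous_lsubmx _ _ _ _ z) (from_coord_cont z1))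
  (cvg_comp_at (@continuous_rsubmx _ _ _ _ z) (from_coord_cont z2))).
Qed.

Lemma prod_coordK c p :
  prod_chart_dom c p -> prod_from_coord c (prod_coord c p) = p.
Proof.
case: p => p q [/= Dp Dq].
by rewrite /prod_from_coord /prod_coord row_mxKl row_mxKr !coordK.
Qed.

Lemma prod_chart_cover p : exists c, prod_chart_dom c p.
Proof.
by have [[c1 ?] [c2 ?]] := (chart_cover p.1, chart_cover p.2); exists (c1, c2).
Qed.

Lemma prod_transition_smooth c d :
  smooth_on (prod_coord c @` (prod_chart_dom c `&` prod_chart_dom d))
            (prod_coord d \o prod_from_coord c).
Proof.
have -> : prod_chart_dom c `&` prod_chart_dom d =
    (chart_dom c.1 `&` chart_dom d.1) `*` (chart_dom c.2 `&` chart_dom d.2).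
  by apply/seteqP; split=> -[p q] [] [/= ? ?] [/= ? ?].
rewrite prod_chart_imgE => z [/= z1 z2].
have [U1 [F1 [oU1 U1z k1 e1]]] := transition_smooth z1.
have [U2 [F2 [oU2 U2z k2 e2]]] := transition_smooth z2.
exists (lsubmx @^-1` U1 `&` rsubmx @^-1` U2),
  (fun z => row_mx (F1 (lsubmx z)) (F2 (rsubmx z))).
split=> //; first exact: open_split_mx.
  by move=> k; apply: Ck_row_mx => //; exact: open_split_mx.
move=> x [/= U1x U2x] [/= x1 x2].
by rewrite /prod_coord /prod_from_coord /= e1 // e2.
Qed.

Definition prod_manifold : manifold R (m1 + m2) :=
  @Manifold R (m1 + m2) (M1 * M2)%type
    (hausdorff_prod (@manifold_hausdorff _ _ M1) (@manifold_hausdorff _ _ M2))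
    (second_countable_prod (@manifold_second_countable _ _ M1)
                           (@manifold_second_countable _ _ M2))
    (chart M1 * chart M2)%type prod_chart_dom prod_coord prod_from_coord
    prod_open_dom prod_open_img prod_coord_cont prod_from_coord_cont
    prod_coordK prod_chart_cover prod_transition_smooth.

End ProductManifold.

Section RiemannianGeometry.
Context {R : realType} {n : nat}.
Variable M : manifold R n.

(* A covariant 2-tensor field, given by its matrix of components in every    *)
(* chart; only the values on [chart_img c] matter.                           *)
Definition tensor2 := chart M -> 'rV[R]_n -> 'M[R]_n.

(* ['J f x] is the matrix of the differential acting on row vectors, so its  *)
(* (a, b) entry is the a-th partial derivative of the b-th component.        *)
Definition tensorial (T : tensor2) : Prop :=
  forall (c d : chart M) x, (coord c @` (chart_dom c `&` chart_dom d)) x ->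
    let tau := coord d \o from_coord c in
    T c x = 'J tau x *m T d (tau x) *m ('J tau x)^T.

Definition riemannian_metric (g : tensor2) : Prop :=
  [/\ tensorial g,
      forall c, smooth_on (chart_img c) (g c),
      forall c x, chart_img c x -> (g c x)^T = g c x
    & forall c x, chart_img c x ->
        forall v : 'rV[R]_n, v != 0 -> 0 < (v *m g c x *m v^T) 0 0].

Definition ricci (g : tensor2) : tensor2 := fun c => ricci_mx (g c).

Definition laplacian (g T : tensor2) : tensor2 :=
  fun c => laplacian_mx (g c) (T c).

Definition einstein (g : tensor2) (k : R) : Prop :=
  forall c x, chart_img c x -> ricci g c x = k *: g c x.

Definition smooth_tensor_family (J : set R) (T : R -> tensor2) : Prop :=
  forall c, smooth_on (chart_img c `*` J)
    (fun p : 'rV[R]_n * R => T p.2 c p.1).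

Definition smooth_function_family (J : set R) (f : M -> R -> R) : Prop :=
  forall c, smooth_on (chart_img c `*` J)
    (fun p : 'rV[R]_n * R => f (from_coord c p.1) p.2).

Definition ricci_flow (J : set R) (g : R -> tensor2) : Prop :=
  forall c x t, chart_img c x -> J t -> forall a b : 'I_n,
    has_derivative_within J (fun s => g s c x a b) t (- 2 * ricci (g t) c x a b).

End RiemannianGeometry.

(* Components of pi_1^* g1 + (lambda o pi_1)^2 pi_2^* g2 in the product       *)
(* chart [c]: the coordinates are the row [row_mx x y].                      *)
Definition warped_metric (R : realType) (m1 m2 : nat)
    (M1 : manifold R m1) (M2 : manifold R m2)
    (g1 : tensor2 M1) (lambda : M1 -> R) (g2 : tensor2 M2) :
  tensor2 (prod_manifold M1 M2) :=
  fun c z => block_mx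
    (g1 c.1 (lsubmx z)) 0
    0 (lambda (from_coord c.1 (lsubmx z)) ^+ 2 *: g2 c.2 (rsubmx z)).

(* Main.v *)
(* In the frame of a product chart the Ricci tensor of g1 + lambda^2 g2 is block  *)
(* diagonal: with Ric(g2) = c g2, its fibre block is mu g2, where                 *)
(*   mu = c - lambda Lap lambda - (m2 - 1) |d lambda|^2,                          *)
(* and its base block is P = Ric(g1) - (m2 / lambda) Hess lambda.  Put            *)
(* nu = mu / lambda^2.  The Christoffel symbols of the warped product give        *)
(*   (Lap Ric)_ab = (lambda^2 Lap nu + m2 lambda <d lambda, d nu>                 *)
(*                   - 2 nu |d lambda|^2 + 2 P(grad lambda, grad lambda)) g2_ab.  *)
(* The flow says that g1 moves with velocity -2 P and lambda with velocity        *)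
(* - lambda nu, so the time derivative of mu follows from the first variation of  *)
(* the Laplacian.  That variation contains 2 div P - d tr P, which the contracted *)
(* second Bianchi identity of the warped metric expresses through nu and P; the   *)
(* two formulas then differ exactly by the zero-order terms of the statement.     *)
(*                                                                                *)
(* The tensor calculus is carried out in a commutative ring with commuting        *)
(* derivations, instantiated by the smooth functions of (x, y, t) on a            *)
(* neighbourhood of the given point.  The metric is only given for t in J, which  *)
(* may contain an end point; its smooth extensions belong to the ring, but they   *)
(* satisfy the flow equation at times of J only.                                  *)

Require Import Defs.
From HB Require Import structures.
From mathcomp Require Import all_boot all_order all_algebra.
From mathcomp Require Import all_classical all_reals all_analysis.
From mathcomp Require Import ring.

Set Implicit Arguments.
Unset Strict Implicit.
Unset Printing Implicit Defensive.

Import Order.TTheory GRing.Theory Num.Theory.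
Import numFieldNormedType.Exports.

Local Open Scope ring_scope.

(** * Tensor calculus in a differential ring *)

(** The fibre block of the Ricci tensor is [ric_mu] times the fixed matrix [gam], so the claim is a
    scalar identity for functions of the base point and of time. Its right side is the coefficient
    found in [laplacian_ric] plus two zero-order terms. By [ricLL], Ric - Ric1 equals -(m2 / lam)
    Hess lam on the base, so these terms are 2 lam nu Lap lam and -2 lam <P, Hess lam>.

    The left side is the time derivative of mu = c - lam Lap lam - (m2 - 1) |d lam|^2, computed by
    [dt_flap] and [dt_fdot] and gathered in [dt_mu]. The velocities -2 P of the base metric and -lam
    nu of the warping function are then inserted ([g_flow], [lam_flow]). Moving the inverse metric
    in Lap lam produces <P, Hess lam>; the velocity of lam produces Lap nu, <d lam, d nu> and nu Lap
    lam; moving the connection produces <2 div P - d tr P, d lam>. This last pairing involves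
    derivatives of the curvature of the base. It is removed by [base_bianchi], which is
    [contracted_bianchi] for the whole warped metric, read in a base direction. [mu_var_flow]
    collects everything.

    All this is algebra over a commutative ring with commuting derivations. The ring is [smfun],
    whose derivations commute by [schwarz], and the [represents] lemmas identify the formal tensors
    with the analytic ones. As the flow equation is available on a time slice only, velocities stay
    formal parameters ([flap_var], [mu_var]) until [ricci_evolution_at] substitutes them through
    [slice_eq]. *)

Record derivation (A : pzRingType) (d : A -> A) : Prop := Derivation {
  derD : {morph d : x y / x + y};
  derM : forall x y, d (x * y) = d x * y + x * d y }.

Section Derivations.
Context {A : comPzRingType} (d : A -> A) (dP : derivation d).

Lemma der0 : d 0 = 0.
Proof. by apply: (addrI (d 0)); rewrite -derD // !addr0. Qed.

Lemma derN x : d (- x) = - d x.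
Proof. by apply: (addrI (d x)); rewrite -derD // !subrr der0. Qed.

Lemma derB x y : d (x - y) = d x - d y.
Proof. by rewrite derD // derN. Qed.

Lemma der1 : d 1 = 0.
Proof. by apply: (addrI (d 1)); rewrite addr0 -{3}[1]mulr1 derM // mulr1 mul1r. Qed.

Lemma derMn x n : d (x *+ n) = d x *+ n.
Proof. by elim: n => [|n IH]; rewrite ?mulr0n ?der0 // !mulrS derD // IH. Qed.

Lemma der_nat n : d n%:R = 0.
Proof. by rewrite derMn der1 mul0rn. Qed.

Lemma der_sum (I : Type) (r : seq I) (P : pred I) (F : I -> A) :
  d (\sum_(i <- r | P i) F i) = \sum_(i <- r | P i) d (F i).
Proof. exact: (big_morph d (derD dP) der0). Qed.

Lemma der_inv x y : x * y = 1 -> d y = - (y * y * d x).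
Proof.
move=> xy; have := derM dP x y; rewrite xy der1 => /esym/eqP.
rewrite addrC addr_eq0 => /eqP e.
by rewrite -[d y]mul1r -xy mulrAC [x * _]e; ring.
Qed.

Lemma der_half h : h * 2 = 1 -> d h = 0.
Proof. by rewrite mulrC => /der_inv ->; rewrite der_nat mulr0 oppr0. Qed.

Lemma map_mxD_der m n (X Y : 'M[A]_(m, n)) :
  map_mx d (X + Y) = map_mx d X + map_mx d Y.
Proof. by apply/matrixP=> i j; rewrite !mxE derD. Qed.

Lemma map_mxN_der m n (X : 'M[A]_(m, n)) : map_mx d (- X) = - map_mx d X.
Proof. by apply/matrixP=> i j; rewrite !mxE derN. Qed.

Lemma map_mxM_der m n p (X : 'M[A]_(m, n)) (Y : 'M[A]_(n, p)) :
  map_mx d (X *m Y) = map_mx d X *m Y + X *m map_mx d Y.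
Proof.
apply/matrixP=> i j; rewrite !mxE der_sum -big_split /=.
by apply: eq_bigr => k _; rewrite derM // !mxE.
Qed.

Lemma map_mx1_der n : map_mx d (1%:M : 'M[A]_n) = 0.
Proof. by apply/matrixP=> i j; rewrite !mxE der_nat. Qed.

Lemma map_mx_der_inv n (X Y : 'M[A]_n) : X *m Y = 1%:M ->
  Y *m X = 1%:M -> map_mx d Y = - (Y *m map_mx d X *m Y).
Proof.
move=> XY YX; have := map_mxM_der Y X; rewrite YX map_mx1_der.
move=> /esym/eqP; rewrite addr_eq0 => /eqP e.
by rewrite -[LHS]mulmx1 -XY mulmxA e mulNmx.
Qed.

End Derivations.

Lemma mxDE (A : nmodType) m n (X Y : 'M[A]_(m, n)) i j : (X + Y) i j = X i j + Y i j.
Proof. by rewrite mxE. Qed.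

Lemma mxNE (A : zmodType) m n (X : 'M[A]_(m, n)) i j : (- X) i j = - X i j.
Proof. by rewrite mxE. Qed.

Lemma trmxDE (A : nmodType) m n (X Y : 'M[A]_(m, n)) : (X + Y)^T = X^T + Y^T.
Proof. exact: raddfD. Qed.

Lemma trmxNE (A : zmodType) m n (X : 'M[A]_(m, n)) : (- X)^T = - X^T.
Proof. exact: raddfN. Qed.

(* Over a ring of functions [A] with commuting partial derivatives [d], the   *)
(* formal counterparts of the tensor operators of the statement.              *)
Section FormalMetric.
Context {A : comPzRingType} {n : nat}.
Variables (d : 'I_n -> A -> A) (G Gi : 'M[A]_n) (h : A).
Implicit Types (T : 'M[A]_n) (i j k l m p q : 'I_n) (f u v : A).

(** The ring has no division, so the inverse metric [Gi] and the number one half [h] are data given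
    with their defining equations. *)
Record formal_metric : Prop := FormalMetric {
  fm_der : forall i, derivation (d i);
  fm_comm : forall i j f, d i (d j f) = d j (d i f);
  fm_sym : G^T = G;
  fm_inv : G *m Gi = 1%:M;
  fm_half : h * 2 = 1 }.

Definition fchr k i j : A :=
  h * \sum_l Gi k l * (d i (G j l) + d j (G i l) - d l (G i j)).

Definition friem i j k l : A :=
  d i (fchr l j k) - d j (fchr l i k)
  + \sum_m (fchr l i m * fchr m j k - fchr l j m * fchr m i k).

Definition fric : 'M[A]_n := \matrix_(j, k) \sum_i friem i j k i.

Definition fcov T k i j : A :=
  d k (T i j) - \sum_m (fchr m k i * T m j + fchr m k j * T i m).

Definition fcov2 T k l i j : A :=
  d k (fcov T l i j)
  - \sum_m (fchr m k l * fcov T m i j + fchr m k i * fcov T l m j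
            + fchr m k j * fcov T l i m).

Definition flaplacian T : 'M[A]_n :=
  \matrix_(i, j) \sum_k \sum_l Gi k l * fcov2 T k l i j.

Definition fhess f k l : A := d k (d l f) - \sum_m fchr m k l * d m f.

Definition flap f : A := \sum_k \sum_l Gi k l * fhess f k l.

Definition fdot u v : A := \sum_k \sum_l Gi k l * d k u * d l v.

Definition ftrace T : A := \sum_k \sum_l Gi k l * T k l.

Definition fdiv T j : A := \sum_k \sum_l Gi k l * fcov T k j l.

(* Row [k] of [conn i] is nabla_i d_k; since matrices act on rows, the        *)
(* commutator in [curv] is reversed.                                          *)
Definition conn i : 'M[A]_n := \matrix_(k, l) fchr l i k.

Definition curv i j : 'M[A]_n :=
  map_mx (d i) (conn j) - map_mx (d j) (conn i)
  + conn j *m conn i - conn i *m conn j.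

Lemma connE i k l : conn i k l = fchr l i k.
Proof. by rewrite mxE. Qed.

Lemma friemE i j k l : friem i j k l = curv i j k l.
Proof.
rewrite /friem /curv !mxE -addrA; congr (_ + _).
by rewrite sumrB; congr (_ - _); apply: eq_bigr => m _; rewrite !mxE mulrC.
Qed.

Hypothesis fm : formal_metric.
Let der := fm_der fm.

Lemma fm_invl : Gi *m G = 1%:M.
Proof. exact/mulmx1C/fm_inv. Qed.

Lemma fm_isym : Gi^T = Gi.
Proof.
have := fm_inv fm; move/(congr1 trmx); rewrite trmx_mul trmx1 (fm_sym fm) => e.
by rewrite -[LHS]mulmx1 -(fm_inv fm) mulmxA e mul1mx.
Qed.

Lemma G_sym i j : G i j = G j i.
Proof. by rewrite -[in LHS](fm_sym fm) mxE. Qed.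

Lemma Gi_sym i j : Gi i j = Gi j i.
Proof. by rewrite -[in LHS]fm_isym mxE. Qed.

Lemma fchr_sym k i j : fchr k i j = fchr k j i.
Proof.
congr (_ * _); apply: eq_bigr => l _; rewrite (G_sym i j).
by rewrite [d i _ + _]addrC.
Qed.

Lemma sum_GiG i k : \sum_l Gi i l * G l k = (i == k)%:R.
Proof. by have /matrixP/(_ i k) := fm_invl; rewrite !mxE. Qed.

Lemma sum_GGi i k : \sum_l G i l * Gi l k = (i == k)%:R.
Proof. by have /matrixP/(_ i k) := fm_inv fm; rewrite !mxE. Qed.

Lemma sum_delta (F : 'I_n -> A) k : \sum_l (l == k)%:R * F l = F k.
Proof.
by rewrite (bigD1 k) //= eqxx mul1r big1 ?addr0 // => l /negbTE ->; rewrite mul0r.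
Qed.

Lemma fchr_low i j l :
  \sum_k fchr k i j * G k l = h * (d i (G j l) + d j (G i l) - d l (G i j)).
Proof.
rewrite /fchr; under eq_bigr do rewrite -mulrA mulr_suml.
rewrite -mulr_sumr exchange_big /=; congr (_ * _).
rewrite -[RHS](sum_delta (fun q => d i (G j q) + d j (G i q) - d q (G i j))).
apply: eq_bigr => q _; rewrite eq_sym -sum_GGi mulr_suml.
by apply: eq_bigr => k _; rewrite (G_sym k l); ring.
Qed.

Lemma compat i : map_mx (d i) G = conn i *m G + G *m (conn i)^T.
Proof.
apply/matrixP=> j k; rewrite !mxE.
under eq_bigr do rewrite mxE.
under [X in _ + X]eq_bigr => l _ do rewrite !mxE mulrC [G j l]G_sym.
rewrite !fchr_low (G_sym k j); transitivity ((h * 2) * d i (G j k)).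
  by rewrite (fm_half fm) mul1r.
ring.
Qed.

Lemma compat_inv i : map_mx (d i) Gi = - (Gi *m conn i) - (conn i)^T *m Gi.
Proof.
rewrite (map_mx_der_inv (der i) (fm_inv fm) fm_invl) compat.
by rewrite mulmxDr mulmxDl !mulmxA fm_invl mul1mx -mulmxA (fm_inv fm) mulmx1 opprD.
Qed.

Lemma der_Gi i k l :
  d i (Gi k l) = - \sum_m (Gi k m * fchr l i m + fchr k i m * Gi m l).
Proof.
have /matrixP/(_ k l) := compat_inv i; rewrite !mxE => ->.
by rewrite -opprD -big_split /=; congr (- _); apply: eq_bigr => m _; rewrite !mxE.
Qed.

Lemma curvN i j : curv i j = - curv j i.
Proof.
by apply/matrixP=> k l; rewrite /curv !(mxDE, mxNE); ring.
Qed.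

Lemma trmx_curv i j : (curv i j)^T = map_mx (d i) (conn j)^T
  - map_mx (d j) (conn i)^T + (conn i)^T *m (conn j)^T - (conn j)^T *m (conn i)^T.
Proof. by rewrite /curv !(trmxDE, trmxNE) !trmx_mul !map_trmx. Qed.

(** Second derivatives of [G] commute; expanding both orders by metric compatibility leaves exactly
    the curvature acting on the two indices of [G]. *)
Lemma curv_antisym i j : curv i j *m G = - (G *m (curv i j)^T).
Proof.
have e a b : map_mx (d a) (map_mx (d b) G) =
    map_mx (d a) (conn b) *m G + conn b *m conn a *m G + conn b *m G *m (conn a)^T
    + conn a *m G *m (conn b)^T + G *m (conn a)^T *m (conn b)^T
    + G *m map_mx (d a) (conn b)^T.
  rewrite compat map_mxD_der // !map_mxM_der // compat.
  by rewrite !(mulmxDl, mulmxDr) !mulmxA !addrA.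
have c : map_mx (d i) (map_mx (d j) G) = map_mx (d j) (map_mx (d i) G).
  by apply/matrixP=> k l; rewrite !mxE (fm_comm fm).
apply/eqP; rewrite -addr_eq0; apply/eqP.
move: c; rewrite !e => /eqP; rewrite -subr_eq0 => /eqP <-.
rewrite trmx_curv /curv !(mulmxDl, mulmxDr, mulNmx, mulmxN) !mulmxA.
by apply/matrixP=> k l; rewrite !(mxDE, mxNE); ring.
Qed.

(** The covariant derivative of the curvature in its endomorphism indices only, as in the exterior
    covariant derivative of a matrix-valued 2-form. The Christoffel terms of the form indices come
    in with [ncurv] and cancel in the cyclic sum. *)
Definition dcurv i j k : 'M[A]_n :=
  map_mx (d i) (curv j k) + curv j k *m conn i - conn i *m curv j k.

Lemma dcurv_cycle i j k : dcurv i j k + dcurv j k i + dcurv k i j = 0.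
Proof.
have c (X : 'M[A]_n) a b : map_mx (d a) (map_mx (d b) X) = map_mx (d b) (map_mx (d a) X).
  by apply/matrixP=> p q; rewrite !mxE (fm_comm fm).
rewrite /dcurv /curv !(map_mxN_der, map_mxD_der) // !map_mxM_der //.
rewrite (c _ j i) (c _ k i) (c _ k j).
rewrite !(mulmxDl, mulmxDr, mulNmx, mulmxN) !mulmxA.
by apply/matrixP=> p q; rewrite !(mxDE, mxNE) [RHS]mxE; ring.
Qed.

Lemma dcurv_antisym i j k : dcurv i j k *m G = - (G *m (dcurv i j k)^T).
Proof.
rewrite /dcurv; move: (curv j k) (curv_antisym j k) => F FG.
have := congr1 (map_mx (d i)) FG.
rewrite map_mxN_der // !map_mxM_der // compat => /eqP.
rewrite -subr_eq0 opprK => /eqP e.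
apply/eqP; rewrite -subr_eq0 opprK -e; apply/eqP.
rewrite !(trmxDE, trmxNE) !trmx_mul !map_trmx.
rewrite !(mulmxDl, mulmxDr, mulNmx, mulmxN) !mulmxA FG.
have -> : conn i *m F *m G = - (conn i *m G *m F^T).
  by rewrite -[LHS]mulmxA FG mulmxN mulmxA.
rewrite mulNmx.
by apply/matrixP=> p q; rewrite !(mxDE, mxNE); ring.
Qed.

Definition ncurv i j k : 'M[A]_n :=
  dcurv i j k - \sum_p fchr p i j *: curv p k - \sum_p fchr p i k *: curv j p.

Lemma ncurv_cycle i j k : ncurv i j k + ncurv j k i + ncurv k i j = 0.
Proof.
rewrite -(dcurv_cycle i j k) /ncurv.
move: (dcurv i j k) (dcurv j k i) (dcurv k i j) => X Y Z.
have e a b c : \sum_p fchr p a c *: curv b p = - \sum_p fchr p c a *: curv p b.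
  by rewrite -sumrN; apply: eq_bigr => p _; rewrite fchr_sym curvN scalerN.
rewrite (e i j k) (e j k i) (e k i j).
move: curv fchr {e} => F c.
by apply/matrixP=> p q; rewrite !(mxDE, mxNE); ring.
Qed.

Lemma ncurvN i j k : ncurv i j k = - ncurv i k j.
Proof.
have dN : dcurv i j k = - dcurv i k j.
  rewrite /dcurv [curv j k]curvN mulNmx mulmxN; move: (curv k j) => X.
  rewrite map_mxN_der //.
  by apply/matrixP=> p q; rewrite !(mxDE, mxNE); ring.
have e a b : \sum_p fchr p i a *: curv b p = - \sum_p fchr p i a *: curv p b.
  by rewrite -sumrN; apply: eq_bigr => p _; rewrite curvN scalerN.
rewrite /ncurv dN (e k j) (e j k); move: (dcurv i k j) => X.
move: curv fchr {e dN} => F c.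
by apply/matrixP=> p q; rewrite !(mxDE, mxNE); ring.
Qed.

Lemma ncurv_antisym i j k : Gi *m ncurv i j k = - ((ncurv i j k)^T *m Gi).
Proof.
have e : ncurv i j k *m G = - (G *m (ncurv i j k)^T).
  have s (c : 'I_n -> A) (F : 'I_n -> 'M[A]_n) : (forall p, F p *m G = - (G *m (F p)^T)) ->
      (\sum_p c p *: F p) *m G = - (G *m (\sum_p c p *: F p)^T).
    move=> H; rewrite raddf_sum /= mulmx_suml mulmx_sumr -sumrN.
    by apply: eq_bigr => p _; rewrite linearZ /= -scalemxAl -scalemxAr H scalerN.
  have s1 := s _ _ (fun p => curv_antisym p k).
  have s2 := s _ _ (fun p => curv_antisym j p).
  rewrite /ncurv; move: (dcurv i j k) (dcurv_antisym i j k) => X XG.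
  move: (\sum_p _) (s1 (fun p => fchr p i j)) => Y YG.
  move: (\sum_p _) (s2 (fun p => fchr p i k)) => Z ZG.
  rewrite !(trmxDE, trmxNE) !(mulmxDl, mulmxDr, mulNmx, mulmxN) XG YG ZG.
  by apply/matrixP=> p q; rewrite !(mxDE, mxNE); ring.
move: (ncurv i j k) e => N e.
rewrite -[LHS]mulmx1 -(fm_inv fm) mulmxA -[Gi *m _ *m G]mulmxA e mulmxN.
by rewrite mulmxA fm_invl mul1mx mulNmx.
Qed.

Lemma fric_curv j k : fric j k = \sum_i curv i j k i.
Proof. by rewrite mxE; apply: eq_bigr => i _; rewrite friemE. Qed.

(** Contraction commutes with covariant differentiation. *)
Lemma sum_ncurv k j l : \sum_i ncurv k i j l i = fcov fric k j l.
Proof.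
rewrite /ncurv /dcurv /fcov fric_curv der_sum //.
under eq_bigr do rewrite !(mxDE, mxNE) [map_mx _ _ _ _]mxE !summxE.
rewrite !big_split /= !sumrN -!addrA; congr (_ + _).
(* [e1] and [e2] are the Christoffel terms of the two contracted indices: they have the same value
   and enter with opposite signs. *)
have e1 : \sum_i (curv i j *m conn k) l i = \sum_i \sum_p fchr i k p * curv i j l p.
  by apply: eq_bigr => i _; rewrite mxE; apply: eq_bigr => p _; rewrite connE mulrC.
have e2 : \sum_i \sum_p (fchr p k i *: curv p j) l i
    = \sum_i \sum_p fchr i k p * curv i j l p.
  by rewrite exchange_big /=; do 2!apply: eq_bigr => ? _; rewrite mxE.
have e3 : \sum_i (conn k *m curv i j) l i = \sum_m fchr m k l * fric j m.
  under eq_bigr do rewrite mxE.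
  rewrite exchange_big /=; apply: eq_bigr => m _; rewrite fric_curv mulr_sumr.
  by apply: eq_bigr => i _; rewrite connE.
have e4 : \sum_i \sum_p (fchr p k j *: curv i p) l i = \sum_m fchr m k j * fric m l.
  rewrite exchange_big /=; apply: eq_bigr => m _; rewrite fric_curv mulr_sumr.
  by apply: eq_bigr => i _; rewrite mxE.
rewrite e1 e2 e3 e4; ring.
Qed.

Lemma der_ftrace T j : d j (ftrace T) = \sum_k \sum_l Gi k l * fcov T j k l.
Proof.
rewrite /ftrace der_sum //.
transitivity (\sum_k \sum_l (Gi k l * d j (T k l)) + \sum_k \sum_l d j (Gi k l) * T k l).
  rewrite -big_split /=; apply: eq_bigr => k _; rewrite der_sum // -big_split /=.
  by apply: eq_bigr => l _; rewrite derM // addrC.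
rewrite /fcov.
under [RHS]eq_bigr do under eq_bigr do rewrite mulrBr.
under [RHS]eq_bigr do rewrite sumrB.
rewrite sumrB; congr (_ + _).
under eq_bigr do under eq_bigr do rewrite der_Gi mulNr mulr_suml.
under eq_bigr do rewrite sumrN; rewrite sumrN; congr (- _).
under eq_bigr do under eq_bigr do (under eq_bigr do rewrite mulrDl; rewrite big_split /=).
under eq_bigr do rewrite big_split /=; rewrite big_split /= addrC.
under [RHS]eq_bigr do under eq_bigr do
  (rewrite mulr_sumr; under eq_bigr do rewrite mulrDr; rewrite big_split /=).
under [RHS]eq_bigr do rewrite big_split /=; rewrite big_split /=; congr (_ + _).
  under eq_bigr do rewrite exchange_big /=.
  rewrite exchange_big /=; apply: eq_bigr => k _; rewrite exchange_big /=.
  by do 2!apply: eq_bigr => ? _; ring.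
apply: eq_bigr => k _; rewrite exchange_big /=.
by do 2!apply: eq_bigr => ? _; ring.
Qed.

(** The second Bianchi identity is traced twice: [s1] contracts the differentiation index with the
    upper index of the curvature, and the remaining pair is then contracted with [Gi]. By
    antisymmetry of the curvature in its last pair ([s2]), the first term becomes a second copy of
    the divergence of Ricci. *)
Lemma contracted_bianchi j : 2 * fdiv fric j = d j (ftrace fric).
Proof.
rewrite der_ftrace.
have cyc i k l : ncurv i j k l i + ncurv j k i l i + ncurv k i j l i = 0.
  move: (ncurv i j k) (ncurv j k i) (ncurv k i j) (ncurv_cycle i j k) => X Y Z.
  by move/matrixP/(_ l i); rewrite !mxE.
have s1 k l : \sum_i ncurv i j k l i - fcov fric j k l + fcov fric k j l = 0.
  rewrite -(sum_ncurv j k) -(sum_ncurv k j) -sumrB -big_split /= big1 // => i _.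
  by rewrite -[RHS](cyc i k l) (ncurvN j k i) mxNE.
have s2 i : \sum_k \sum_l Gi k l * ncurv i j k l i = \sum_l Gi i l * fcov fric i j l.
  have e k : \sum_l Gi k l * ncurv i j k l i = - \sum_l ncurv i j k l k * Gi l i.
    have /matrixP/(_ k i) := ncurv_antisym i j k; rewrite !mxE => ->.
    by congr (- _); apply: eq_bigr => l _; rewrite mxE.
  under eq_bigr do rewrite e.
  rewrite sumrN exchange_big /= -sumrN; apply: eq_bigr => l _.
  rewrite -mulr_suml -(sum_ncurv i j l) Gi_sym mulrC -mulrN; congr (_ * _).
  by rewrite -sumrN; apply: eq_bigr => k _; rewrite ncurvN mxNE opprK.
have : \sum_k \sum_l Gi k l * (\sum_i ncurv i j k l i - fcov fric j k l + fcov fric k j l) = 0.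
  by rewrite big1 // => k _; rewrite big1 // => l _; rewrite s1 mulr0.
under eq_bigr do (under eq_bigr do rewrite mulrDr mulrBr; rewrite !big_split /= sumrN).
rewrite !big_split /= sumrN.
have -> : \sum_k \sum_l Gi k l * (\sum_i ncurv i j k l i) = fdiv fric j.
  under eq_bigr do (under eq_bigr do rewrite mulr_sumr; rewrite exchange_big /=).
  by rewrite exchange_big /=; apply: eq_bigr => i _; rewrite s2.
rewrite -/(fdiv fric j) => /eqP; rewrite addrAC subr_eq0 => /eqP <-.
ring.
Qed.

End FormalMetric.

(** * Hessian and Laplacian of functions, and their first variation *)

Section FormalAnalysis.
Context {A : comPzRingType} {n : nat}.
Variables (d : 'I_n -> A -> A) (G Gi : 'M[A]_n) (h : A).
Hypothesis fm : formal_metric d G Gi h.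
Implicit Types (i j k l m p q : 'I_n) (f u v : A).
Let der := fm_der fm.
Local Notation chr := (fchr d G Gi h).
Local Notation hess := (fhess d G Gi h).
Local Notation lap := (flap d G Gi h).
Local Notation dot := (fdot d Gi).
Local Notation cov := (fcov d G Gi h).

(** For an actual metric this is the logarithmic derivative of the volume density; it enters both
    the Ricci tensor and the divergence form of the Laplacian. *)
Definition fctr k : A := \sum_i chr i i k.

Definition fgrad f k : A := \sum_l Gi k l * d l f.

Lemma fricE j k : fric d G Gi h j k =
  \sum_i d i (chr i j k) - d j (fctr k) + \sum_m fctr m * chr m j k
  - \sum_i \sum_m chr i j m * chr m i k.
Proof.
rewrite mxE /friem !big_split /= sumrN -(der_sum (der j)) -!addrA; congr (_ + (_ + _)).
under eq_bigr do rewrite sumrB.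
rewrite sumrB; congr (_ - _).
by rewrite exchange_big; apply: eq_bigr => m _; rewrite mulr_suml.
Qed.

Lemma fdotC u v : dot u v = dot v u.
Proof.
rewrite /fdot exchange_big; do 2!apply: eq_bigr => ? _.
by rewrite (Gi_sym fm); ring.
Qed.

Lemma fdotE u v : dot u v = \sum_k fgrad u k * d k v.
Proof.
rewrite fdotC; apply: eq_bigr => k _; rewrite mulr_suml.
by apply: eq_bigr => l _; ring.
Qed.

Lemma fdotMr u v w : dot u (v * w) = v * dot u w + w * dot u v.
Proof.
rewrite /fdot !mulr_sumr -big_split; apply: eq_bigr => k _ /=.
rewrite !mulr_sumr -big_split; apply: eq_bigr => l _ /=.
by rewrite (derM (der l)); ring.
Qed.

Lemma fhessM u v k l : hess (u * v) k l =
  u * hess v k l + v * hess u k l + d k u * d l v + d l u * d k v.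
Proof.
have e : \sum_m chr m k l * d m (u * v) =
    u * (\sum_m chr m k l * d m v) + v * (\sum_m chr m k l * d m u).
  rewrite !mulr_sumr -big_split; apply: eq_bigr => m _ /=.
  by rewrite (derM (der m)); ring.
rewrite /fhess e (derM (der l)) (derD (der k)) !(derM (der k)); ring.
Qed.

Lemma flapM u v : lap (u * v) = u * lap v + v * lap u + 2 * dot u v.
Proof.
have -> : 2 * dot u v = dot u v + dot v u by rewrite (fdotC v); ring.
rewrite /flap /fdot !mulr_sumr -!big_split; apply: eq_bigr => k _ /=.
rewrite !mulr_sumr -!big_split; apply: eq_bigr => l _ /=.
by rewrite fhessM; ring.
Qed.

Lemma flap_div f : lap f = \sum_i d i (fgrad f i) + \sum_m fctr m * fgrad f m.
Proof.
rewrite /fgrad; under eq_bigr do rewrite (der_sum (der _)).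
have e i : \sum_l d i (Gi i l * d l f) = \sum_l Gi i l * d i (d l f)
   - \sum_l (\sum_m (Gi i m * chr l i m + chr i i m * Gi m l)) * d l f.
  rewrite -sumrB; apply: eq_bigr => l _.
  by rewrite (derM (der i)) (der_Gi fm); ring.
under eq_bigr do rewrite e.
rewrite sumrB.
have -> : \sum_i \sum_l (\sum_m (Gi i m * chr l i m + chr i i m * Gi m l)) * d l f =
    \sum_i \sum_l Gi i l * (\sum_m chr m i l * d m f) + \sum_m fctr m * \sum_l Gi m l * d l f.
  under eq_bigr do (under eq_bigr do rewrite mulr_suml; rewrite exchange_big /=).
  under eq_bigr do (under eq_bigr do (under eq_bigr do rewrite mulrDl; rewrite big_split);
    rewrite big_split).
  rewrite big_split /=; congr (_ + _).
    do 2!apply: eq_bigr => ? _; rewrite mulr_sumr.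
    by apply: eq_bigr => ? _; ring.
  rewrite exchange_big; apply: eq_bigr => m _ /=.
  rewrite mulr_suml; apply: eq_bigr => i _; rewrite mulr_sumr.
  by apply: eq_bigr => l _; ring.
rewrite /flap /fhess.
under eq_bigr do (under eq_bigr do rewrite mulrBr; rewrite sumrB).
rewrite sumrB; ring.
Qed.

Variable dt : A -> A.
Hypotheses (dt_der : derivation dt) (dt_comm : forall i f, dt (d i f) = d i (dt f)).
Local Notation H := (map_mx dt G).

Lemma dt_Gi k l : dt (Gi k l) = - \sum_p \sum_q Gi k p * Gi l q * H p q.
Proof.
have /matrixP/(_ k l) := map_mx_der_inv dt_der (fm_inv fm) (fm_invl fm).
rewrite !mxE => ->; congr (- _).
rewrite exchange_big; apply: eq_bigr => q _ /=; rewrite !mxE mulr_suml.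
by apply: eq_bigr => p _; rewrite !mxE (Gi_sym fm q); ring.
Qed.

(** The variation of the connection is a tensor. It comes from differentiating [fchr_low] in time;
    the Christoffel symbols left over are those needed to turn the partial derivatives of [H] into
    covariant ones. *)
Lemma dt_chr_low i j l : 2 * \sum_k dt (chr k i j) * G k l =
  cov H i j l + cov H j i l - cov H l i j.
Proof.
have := congr1 dt (fchr_low fm i j l).
rewrite (der_sum dt_der) (derM dt_der h) (der_half dt_der (fm_half fm)) mul0r add0r.
under eq_bigr do rewrite (derM dt_der).
rewrite big_split /= => e.
have {}e : \sum_k dt (chr k i j) * G k l =
    h * dt (d i (G j l) + d j (G i l) - d l (G i j)) - \sum_k chr k i j * dt (G k l).
  by rewrite -e; ring.
rewrite e (derB dt_der) (derD dt_der) !dt_comm mulrBr [2 * (h * _)]mulrA [2 * h]mulrC.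
rewrite (fm_half fm) mul1r /fcov !mxE !big_split /=.
have s a b c : \sum_m chr m a b * H c m = \sum_m chr m a b * H m c.
  by apply: eq_bigr => m _; rewrite !mxE (G_sym fm).
rewrite !s.
have t a b (F : 'I_n -> A) : \sum_m chr m a b * F m = \sum_m chr m b a * F m.
  by apply: eq_bigr => m _; rewrite (fchr_sym fm).
rewrite (t j i) (t l i) (t l j).
have -> : \sum_k chr k i j * dt (G k l) = \sum_k chr k i j * H k l.
  by apply: eq_bigr => m _; rewrite !mxE.
ring.
Qed.

Lemma dt_chr_trace k : \sum_i \sum_j Gi i j * dt (chr k i j) =
  \sum_l Gi k l * (fdiv d G Gi h H l - h * d l (ftrace Gi H)).
Proof.
have low l : \sum_i \sum_j Gi i j * \sum_k dt (chr k i j) * G k l =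
    fdiv d G Gi h H l - h * d l (ftrace Gi H).
  rewrite (der_ftrace fm).
  transitivity (h * (2 * \sum_i \sum_j Gi i j * \sum_k dt (chr k i j) * G k l)).
    by rewrite mulrA (fm_half fm) mul1r.
  have -> : fdiv d G Gi h H l = h * (fdiv d G Gi h H l + fdiv d G Gi h H l).
    by rewrite -[LHS]mul1r -(fm_half fm); ring.
  rewrite -mulrBr; congr (_ * _).
  have {2}-> : fdiv d G Gi h H l = \sum_i \sum_j Gi i j * cov H j l i.
    rewrite /fdiv exchange_big; do 2!apply: eq_bigr => ? _.
    by rewrite (Gi_sym fm).
  rewrite -big_split -sumrB mulr_sumr.
  apply: eq_bigr => i _ /=; rewrite -big_split -sumrB mulr_sumr.
  apply: eq_bigr => j _ /=; rewrite mulrCA dt_chr_low.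
  have -> : cov H i j l = cov H i l j.
    rewrite /fcov !mxE (G_sym fm j l); congr (_ - _); apply: eq_bigr => m _.
    by rewrite !mxE addrC (G_sym fm m l) (G_sym fm m j).
  have -> : cov H j i l = cov H j l i.
    rewrite /fcov !mxE (G_sym fm i l); congr (_ - _); apply: eq_bigr => m _.
    by rewrite !mxE addrC (G_sym fm m l) (G_sym fm m i).
  ring.
(* The upper index is lowered with [G] and raised again with [Gi], so that the lowered formula
   applies. *)
transitivity (\sum_l Gi k l * \sum_i \sum_j Gi i j * \sum_k dt (chr k i j) * G k l); last first.
  by apply: eq_bigr => l _; rewrite low.
under [RHS]eq_bigr do rewrite mulr_sumr.
rewrite [RHS]exchange_big; apply: eq_bigr => i _ /=.
under [RHS]eq_bigr do rewrite mulr_sumr.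
rewrite [RHS]exchange_big; apply: eq_bigr => j _ /=.
rewrite -[in LHS](sum_delta (fun p => dt (chr p i j))) mulr_sumr.
under [RHS]eq_bigr do rewrite !mulr_sumr.
rewrite [RHS]exchange_big; apply: eq_bigr => p _ /=.
rewrite eq_sym -(sum_GiG fm) mulr_suml mulr_sumr.
by apply: eq_bigr => l _; rewrite (G_sym fm l p); ring.
Qed.

(* First variation of the Laplacian at the function [f] when the metric moves *)
(* with velocity [T] and [f] moves with velocity [v].                        *)
Definition flap_var (T : 'M[A]_n) f v : A :=
  lap v - \sum_k \sum_l (\sum_p \sum_q Gi k p * Gi l q * T p q) * hess f k l
  - \sum_l (fdiv d G Gi h T l - h * d l (ftrace Gi T)) * fgrad f l.

Lemma dt_flap f : dt (lap f) = flap_var H f (dt f).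
Proof.
rewrite /flap_var /flap (der_sum dt_der).
under eq_bigr do (rewrite (der_sum dt_der); under eq_bigr do
  rewrite (derM dt_der) dt_Gi mulNr addrC; rewrite sumrB).
rewrite sumrB addrAC; congr (_ - _).
rewrite /fhess; under eq_bigr do under eq_bigr do
  rewrite (derB dt_der) (der_sum dt_der) !dt_comm.
have e k l : \sum_m dt (chr m k l * d m f) =
   \sum_m chr m k l * d m (dt f) + \sum_m dt (chr m k l) * d m f.
  rewrite -big_split; apply: eq_bigr => m _ /=.
  by rewrite (derM dt_der) dt_comm addrC.
under eq_bigr do (under eq_bigr do rewrite e opprD addrA mulrBr; rewrite sumrB).
rewrite sumrB; congr (_ - _).
under eq_bigr do under eq_bigr do rewrite mulr_sumr.
under eq_bigr do rewrite exchange_big /=.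
rewrite exchange_big /=.
under [RHS]eq_bigr do rewrite mulr_sumr.
rewrite [RHS]exchange_big /=; apply: eq_bigr => m _.
under eq_bigr do under eq_bigr do rewrite mulrA.
under eq_bigr do rewrite -mulr_suml.
rewrite -mulr_suml dt_chr_trace mulr_suml.
by apply: eq_bigr => l _; rewrite (Gi_sym fm m l); ring.
Qed.

(** The counterpart of [flap_var] for |df|^2. *)
Definition fdot_var (T : 'M[A]_n) f v : A :=
  2 * dot f v - \sum_k \sum_l (\sum_p \sum_q Gi k p * Gi l q * T p q) * (d k f * d l f).

Lemma dt_fdot f : dt (dot f f) = fdot_var H f (dt f).
Proof.
have -> : fdot_var H f (dt f) = dot f (dt f) + dot (dt f) f -
  \sum_k \sum_l (\sum_p \sum_q Gi k p * Gi l q * H p q) * (d k f * d l f).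
  by rewrite /fdot_var (fdotC (dt f)); ring.
rewrite /fdot (der_sum dt_der) -big_split -sumrB; apply: eq_bigr => k _ /=.
rewrite (der_sum dt_der) -big_split -sumrB; apply: eq_bigr => l _ /=.
rewrite !(derM dt_der) dt_Gi !dt_comm; ring.
Qed.

End FormalAnalysis.

(** * Warped products *)

Section WarpedProduct.
Context {A : comPzRingType} {m1 m2 : nat}.
Variables (D : 'I_(m1 + m2) -> A -> A) (g gi : 'M[A]_m1) (gam gami : 'M[A]_m2).
Variables (lam lami h : A).
Local Notation L := (@lshift m1 m2).
Local Notation R := (@rshift m1 m2).
Local Notation d1 := (fun i => D (L i)).
Local Notation d2 := (fun a => D (R a)).
Implicit Types (i j k l m p q : 'I_m1) (a b e : 'I_m2) (f u v : A).

(** [D] lists the space derivatives only: [g] and [lam] do not vary along the fibre, nor [gam] along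
    the base, but all of them may still depend on time. *)
Record warped_data : Prop := WarpedData {
  wd_der : forall s, derivation (D s);
  wd_comm : forall s t f, D s (D t f) = D t (D s f);
  wd_fm1 : formal_metric d1 g gi h;
  wd_fm2 : formal_metric d2 gam gami h;
  wd_lam : lam * lami = 1;
  wd_lamR : forall a, D (R a) lam = 0;
  wd_gR : forall a i j, D (R a) (g i j) = 0;
  wd_gamL : forall i a b, D (L i) (gam a b) = 0 }.

Definition wmet : 'M[A]_(m1 + m2) := block_mx g 0 0 (lam ^+ 2 *: gam).
Definition wmeti : 'M[A]_(m1 + m2) := block_mx gi 0 0 (lami ^+ 2 *: gami).

Hypothesis wd : warped_data.
Let der := wd_der wd.
Let fm1 := wd_fm1 wd.
Let fm2 := wd_fm2 wd.

Local Notation W := wmet.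
Local Notation Wi := wmeti.
Local Notation chr := (fchr D W Wi h).
Local Notation chr1 := (fchr d1 g gi h).
Local Notation chr2 := (fchr d2 gam gami h).
Local Notation ctr := (fctr D W Wi h).
Local Notation ctr1 := (fctr d1 g gi h).
Local Notation ctr2 := (fctr d2 gam gami h).
Local Notation ric := (fric D W Wi h).
Local Notation ric1 := (fric d1 g gi h).
Local Notation ric2 := (fric d2 gam gami h).
Local Notation cov := (fcov D W Wi h).
Local Notation cov1 := (fcov d1 g gi h).
Local Notation cov2 := (fcov2 D W Wi h).
Local Notation lap1 := (flap d1 g gi h).
Local Notation dot1 := (fdot d1 gi).
Local Notation hess1 := (fhess d1 g gi h).
Local Notation grad1 := (fgrad d1 gi).

Lemma WLL i j : W (L i) (L j) = g i j. Proof. exact: block_mxEul. Qed.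
Lemma WLR i a : W (L i) (R a) = 0. Proof. by rewrite /W block_mxEur mxE. Qed.
Lemma WRL i a : W (R a) (L i) = 0. Proof. by rewrite /W block_mxEdl mxE. Qed.
Lemma WRR a b : W (R a) (R b) = lam ^+ 2 * gam a b.
Proof. by rewrite /W block_mxEdr mxE. Qed.
Lemma WiLL i j : Wi (L i) (L j) = gi i j. Proof. exact: block_mxEul. Qed.
Lemma WiLR i a : Wi (L i) (R a) = 0. Proof. by rewrite /Wi block_mxEur mxE. Qed.
Lemma WiRL i a : Wi (R a) (L i) = 0. Proof. by rewrite /Wi block_mxEdl mxE. Qed.
Lemma WiRR a b : Wi (R a) (R b) = lami ^+ 2 * gami a b.
Proof. by rewrite /Wi block_mxEdr mxE. Qed.
Definition WE := (WLL, WLR, WRL, WRR, WiLL, WiLR, WiRL, WiRR).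

Lemma wmet_formal : formal_metric D W Wi h.
Proof.
split=> //; first exact: wd_comm.
- rewrite /W tr_block_mx !trmx0 (fm_sym fm1) linearZ /= (fm_sym fm2) //.
- rewrite /W /Wi mulmx_block !mulmx0 !mul0mx !addr0 add0r (fm_inv fm1).
  rewrite -scalemxAl -scalemxAr (fm_inv fm2) scalerA -exprMn (wd_lam wd) expr1n.
  by rewrite scale1r -scalar_mx_block.
- exact: fm_half fm1.
Qed.
Let fm := wmet_formal.

Let D0 s : D s 0 = 0. Proof. exact: der0. Qed.
Let h2 : h * 2 = 1. Proof. exact: fm_half fm1. Qed.

Lemma D_lam2 s : D s (lam ^+ 2) = 2 * lam * D s lam.
Proof. by rewrite expr2 (derM (der s)); ring. Qed.

Lemma D_lami s : D s lami = - (lami * lami * D s lam).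
Proof. exact: der_inv (der s) _ _ (wd_lam wd). Qed.

Lemma lamiR a : D (R a) lami = 0.
Proof. by rewrite D_lami (wd_lamR wd) mulr0 oppr0. Qed.

Lemma D_R_lam2gam a b e : D (R a) (lam ^+ 2 * gam b e) = lam ^+ 2 * D (R a) (gam b e).
Proof. by rewrite (derM (der _)) D_lam2 (wd_lamR wd) mulr0 mul0r add0r. Qed.

Lemma D_L_lam2gam i b e : D (L i) (lam ^+ 2 * gam b e) = 2 * lam * D (L i) lam * gam b e.
Proof. by rewrite (derM (der _)) D_lam2 (wd_gamL wd) mulr0 addr0. Qed.

Lemma giR a k l : D (R a) (gi k l) = 0.
Proof.
have /matrixP/(_ k l) := map_mx_der_inv (der (R a)) (fm_inv fm1) (fm_invl fm1).
have -> : map_mx (D (R a)) g = 0.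
  by apply/matrixP=> i j; rewrite !mxE (wd_gR wd).
by rewrite mulmx0 mul0mx !mxE oppr0.
Qed.

Lemma gamiL i a b : D (L i) (gami a b) = 0.
Proof.
have /matrixP/(_ a b) := map_mx_der_inv (der (L i)) (fm_inv fm2) (fm_invl fm2).
have -> : map_mx (D (L i)) gam = 0.
  by apply/matrixP=> ? ?; rewrite !mxE (wd_gamL wd).
by rewrite mulmx0 mul0mx !mxE oppr0.
Qed.

Lemma DhM s f : D s (h * f) = h * D s f.
Proof. by rewrite (derM (der s)) (der_half (der s) h2) mul0r add0r. Qed.

Lemma D_R_L a i f : D (R a) f = 0 -> D (R a) (D (L i) f) = 0.
Proof. by move=> e; rewrite (wd_comm wd) e D0. Qed.

Lemma D_L_R a i f : D (L i) f = 0 -> D (L i) (D (R a) f) = 0.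
Proof. by move=> e; rewrite (wd_comm wd) e D0. Qed.

Lemma gradR a f k : D (R a) f = 0 -> D (R a) (grad1 f k) = 0.
Proof.
move=> e; rewrite (der_sum (der _)) big1 // => l _.
by rewrite (derM (der _)) giR (D_R_L _ e); ring.
Qed.

Lemma chr1R a k i j : D (R a) (chr1 k i j) = 0.
Proof.
rewrite DhM (der_sum (der _)) big1 ?mulr0 // => l _.
rewrite (derM (der _)) giR (derB (der _)) (derD (der _)).
by rewrite !D_R_L ?(wd_gR wd); ring.
Qed.

Lemma chr2L i a b e : D (L i) (chr2 a b e) = 0.
Proof.
rewrite DhM (der_sum (der _)) big1 ?mulr0 // => l _.
rewrite (derM (der _)) gamiL (derB (der _)) (derD (der _)).
by rewrite !D_L_R ?(wd_gamL wd); ring.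
Qed.

Lemma chrLLL k i j : chr (L k) (L i) (L j) = chr1 k i j.
Proof.
rewrite /fchr big_split_ord /= [X in _ + X]big1 ?addr0 => [|a _]; last first.
  by rewrite !WE mul0r.
by congr (_ * _); apply: eq_bigr => l _; rewrite !WE.
Qed.

Lemma chrLLR k i a : chr (L k) (L i) (R a) = 0.
Proof.
rewrite /fchr big_split_ord /= !big1 ?addr0 ?mulr0 // => [b _|l _].
  by rewrite !WE mul0r.
by rewrite !WE !D0 (wd_gR wd) ; ring.
Qed.

Lemma chrLRL k i a : chr (L k) (R a) (L i) = 0.
Proof. by rewrite (fchr_sym fm) chrLLR. Qed.

(** This is the second fundamental form of the fibres, which are totally umbilic. *)
Lemma chrLRR k a b : chr (L k) (R a) (R b) = - (lam * grad1 lam k * gam a b).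
Proof.
rewrite /fchr big_split_ord /= [X in _ + X]big1 ?addr0 => [|e _]; last first.
  by rewrite !WE mul0r.
transitivity (- (h * 2 * lam * grad1 lam k * gam a b)); last by rewrite h2 mul1r.
rewrite /fgrad !(mulr_sumr, mulr_suml) -sumrN; apply: eq_bigr => l _.
by rewrite !WE !D0 D_L_lam2gam; ring.
Qed.

Lemma chrRLL a i j : chr (R a) (L i) (L j) = 0.
Proof.
rewrite /fchr big_split_ord /= !big1 ?addr0 ?mulr0 // => [b _|l _].
  by rewrite !WE !D0 (wd_gR wd); ring.
by rewrite !WE mul0r.
Qed.

Lemma lamiE f : lami ^+ 2 * (2 * lam * f) = 2 * lami * f.
Proof. by rewrite -[RHS]mulr1 -(wd_lam wd); ring. Qed.

Lemma chrRLR a i b : chr (R a) (L i) (R b) = (a == b)%:R * (lami * D (L i) lam).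
Proof.
rewrite /fchr big_split_ord /= [X in X + _]big1 ?add0r => [|e _]; last first.
  by rewrite !WE mul0r.
rewrite -(sum_GiG fm2) mulr_suml mulr_sumr.
apply: eq_bigr => e _; rewrite !WE !D0 D_L_lam2gam subr0 addr0.
transitivity (h * gami a e * gam b e * (lami ^+ 2 * (2 * lam * D (L i) lam))); first ring.
rewrite lamiE (G_sym fm2 b); transitivity ((h * 2) * (gami a e * gam e b * (lami * D (L i) lam))).
  ring.
by rewrite h2 mul1r.
Qed.

Lemma chrRRL a i b : chr (R a) (R b) (L i) = (a == b)%:R * (lami * D (L i) lam).
Proof. by rewrite (fchr_sym fm) chrRLR. Qed.

Lemma lami2 f : lami ^+ 2 * (lam ^+ 2 * f) = f.
Proof. by rewrite mulrA -exprMn [lami * _]mulrC (wd_lam wd) expr1n mul1r. Qed.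

Lemma chrRRR a b e : chr (R a) (R b) (R e) = chr2 a b e.
Proof.
rewrite /fchr big_split_ord /= [X in X + _]big1 ?add0r => [|l _]; last first.
  by rewrite !WE mul0r.
congr (_ * _); apply: eq_bigr => l _; rewrite !WE !D_R_lam2gam //.
by rewrite -[RHS]lami2; ring.
Qed.

Definition chrE :=
  (chrLLL, chrLLR, chrLRL, chrLRR, chrRLL, chrRLR, chrRRL, chrRRR).

Lemma sum_deltal (F : 'I_m2 -> A) a : \sum_b (a == b)%:R * F b = F a.
Proof. by under eq_bigr do rewrite eq_sym; rewrite sum_delta. Qed.

Lemma ctrL k : ctr (L k) = ctr1 k + m2%:R * (lami * D (L k) lam).
Proof.
rewrite /fctr big_split_ord /=; congr (_ + _).
  by apply: eq_bigr => i _; rewrite chrE.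
rewrite (eq_bigr (fun=> lami * D (L k) lam)) => [|a _].
  by rewrite sumr_const card_ord mulr_natl.
by rewrite chrE eqxx mul1r.
Qed.

Lemma ctrR a : ctr (R a) = ctr2 a.
Proof.
rewrite /fctr big_split_ord /= big1 => [|i _]; last by rewrite chrE.
by rewrite add0r; apply: eq_bigr => b _; rewrite chrE.
Qed.

Lemma ctr1R a k : D (R a) (ctr1 k) = 0.
Proof. by rewrite (der_sum (der _)) big1 // => i _; rewrite chr1R. Qed.

Lemma ctr2L i a : D (L i) (ctr2 a) = 0.
Proof. by rewrite (der_sum (der _)) big1 // => b _; rewrite chr2L. Qed.

Lemma DnatM s n f : D s (n%:R * f) = n%:R * D s f.
Proof. by rewrite (derM (der s)) (der_nat (der s)) mul0r add0r. Qed.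

(** The fibre adds m2 d(log lam) to the contracted Christoffel symbol. Its covariant derivative and
    the square m2 (d log lam)^2 from the mixed symbols, both subtracted, combine to the Hessian of
    lam itself. *)
Lemma ricLL j k : ric (L j) (L k) = ric1 j k - m2%:R * lami * hess1 lam j k.
Proof.
rewrite (fricE fm) (fricE fm1) !big_split_ord /=.
rewrite [X in _ + X - _ + _ - _]big1 ?addr0 => [|a _]; last by rewrite !chrE D0.
rewrite [X in _ - _ + (_ + X) - _]big1 ?addr0 => [|a _]; last by rewrite !chrE mulr0.
have -> : \sum_i D (L i) (chr (L i) (L j) (L k)) = \sum_i D (L i) (chr1 i j k).
  by apply: eq_bigr => i _; rewrite chrE.
have -> : \sum_m ctr (L m) * chr (L m) (L j) (L k) =
    \sum_m ctr1 m * chr1 m j k + m2%:R * lami * (\sum_m chr1 m j k * D (L m) lam).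
  rewrite mulr_sumr -big_split; apply: eq_bigr => m _ /=.
  by rewrite ctrL chrE; ring.
have -> : \sum_i \sum_s chr (L i) (L j) s * chr s (L i) (L k) =
    \sum_i \sum_m chr1 i j m * chr1 m i k.
  apply: eq_bigr => i _; rewrite big_split_ord /= [X in _ + X]big1 ?addr0 => [|a _].
    by apply: eq_bigr => m _; rewrite !chrE.
  by rewrite !chrE mul0r.
have -> : \sum_a \sum_s chr (R a) (L j) s * chr s (R a) (L k) =
    m2%:R * (lami * D (L j) lam * (lami * D (L k) lam)).
  rewrite (eq_bigr (fun=> lami * D (L j) lam * (lami * D (L k) lam))) => [|a _].
    by rewrite sumr_const card_ord mulr_natl.
  rewrite big_split_ord /= big1 ?add0r => [|m _]; last by rewrite !chrE mul0r.
  under eq_bigr do rewrite !chrE -mulrA.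
  by rewrite sum_deltal eqxx mul1r.
rewrite ctrL (derD (der _)) DnatM (derM (der _)) D_lami /fhess; ring.
Qed.

Lemma ricLR j b : ric (L j) (R b) = 0.
Proof.
rewrite (fricE fm) !big_split_ord /=.
rewrite big1 => [|i _]; last by rewrite chrE D0.
rewrite ctrR ctr2L.
have -> : \sum_a D (R a) (chr (R a) (L j) (R b)) = 0.
  rewrite big1 // => a _; rewrite chrE DnatM (derM (der _)) lamiR.
  by rewrite (D_R_L _ (wd_lamR wd a)); ring.
rewrite [X in _ + (X + _) - _]big1 ?add0r => [|i _]; last by rewrite chrE mulr0.
have -> : \sum_a ctr (R a) * chr (R a) (L j) (R b) = lami * D (L j) lam * ctr2 b.
  under eq_bigr do rewrite chrE ctrR mulrCA eq_sym.
  by rewrite sum_deltal mulrC.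
rewrite [X in _ - (X + _)]big1 => [|i _]; last first.
  by rewrite big_split_ord /= !big1 ?addr0 // => [a _|k _]; rewrite !chrE ?mul0r ?mulr0.
have -> : \sum_a \sum_s chr (R a) (L j) s * chr s (R a) (R b) = lami * D (L j) lam * ctr2 b.
  rewrite [RHS]mulr_sumr; apply: eq_bigr => a _.
  rewrite big_split_ord /= big1 ?add0r => [|m _]; last by rewrite !chrE mul0r.
  under eq_bigr do rewrite !chrE -mulrA.
  by rewrite sum_deltal.
ring.
Qed.

Lemma ricRL j b : ric (R b) (L j) = 0.
Proof.
rewrite (fricE fm) !big_split_ord /=.
rewrite big1 => [|i _]; last by rewrite chrE D0.
rewrite ctrL (derD (der _)) ctr1R DnatM (derM (der _)) lamiR (D_R_L _ (wd_lamR wd b)).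
have -> : \sum_a D (R a) (chr (R a) (R b) (L j)) = 0.
  rewrite big1 // => a _; rewrite chrE DnatM (derM (der _)) lamiR.
  by rewrite (D_R_L _ (wd_lamR wd a)); ring.
rewrite [X in _ + (X + _) - _]big1 ?add0r => [|i _]; last by rewrite chrE mulr0.
have -> : \sum_a ctr (R a) * chr (R a) (R b) (L j) = lami * D (L j) lam * ctr2 b.
  under eq_bigr do rewrite chrE ctrR mulrCA eq_sym.
  by rewrite sum_deltal mulrC.
rewrite [X in _ - (X + _)]big1 => [|i _]; last first.
  by rewrite big_split_ord /= !big1 ?addr0 // => [a _|k _]; rewrite !chrE ?mul0r ?mulr0.
have -> : \sum_a \sum_s chr (R a) (R b) s * chr s (R a) (L j) = lami * D (L j) lam * ctr2 b.
  rewrite [RHS]mulr_sumr; apply: eq_bigr => a _.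
  rewrite big_split_ord /= big1 ?add0r => [|m _]; last by rewrite !chrE mulr0.
  under eq_bigr do rewrite !chrE eq_sym mulrCA.
  by rewrite sum_deltal mulrC (fchr_sym fm2).
ring.
Qed.

(** The factor m2 - 1 is 1 + m2 - 2: one from the product rule in the divergence of lam grad lam, m2
    from the contracted Christoffel symbol, and -2 from the two products of mixed symbols. *)
Lemma ricRR a b : ric (R a) (R b) = ric2 a b
  - (lam * lap1 lam + (m2%:R - 1) * dot1 lam lam) * gam a b.
Proof.
rewrite (fricE fm) (fricE fm2) !big_split_ord /= (flap_div fm1) (fdotE fm1).
have -> : \sum_i D (L i) (chr (L i) (R a) (R b)) =
   - ((lam * \sum_i D (L i) (grad1 lam i) + \sum_k grad1 lam k * D (L k) lam) * gam a b).
  rewrite mulr_sumr -big_split mulr_suml -sumrN; apply: eq_bigr => i _ /=.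
  by rewrite chrE (derN (der _)) !(derM (der _)) (wd_gamL wd); ring.
have -> : \sum_e D (R e) (chr (R e) (R a) (R b)) = \sum_e D (R e) (chr2 e a b).
  by apply: eq_bigr => e _; rewrite chrE.
have -> : \sum_m ctr (L m) * chr (L m) (R a) (R b) =
   - (lam * (\sum_m ctr1 m * grad1 lam m) + m2%:R * \sum_k grad1 lam k * D (L k) lam) * gam a b.
  rewrite !mulr_sumr -big_split mulNr mulr_suml -sumrN; apply: eq_bigr => m _ /=.
  rewrite chrE ctrL -[m2%:R * (grad1 lam m * _)]mul1r -(wd_lam wd); ring.
have -> : \sum_e ctr (R e) * chr (R e) (R a) (R b) = \sum_e ctr2 e * chr2 e a b.
  by apply: eq_bigr => e _; rewrite chrE ctrR.
have s1 k e : lam * grad1 lam k * gam a e * (lami * D (L k) lam) =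
    grad1 lam k * D (L k) lam * gam a e.
  by rewrite -[RHS]mulr1 -(wd_lam wd); ring.
have -> : \sum_i \sum_s chr (L i) (R a) s * chr s (L i) (R b) =
   - (\sum_k grad1 lam k * D (L k) lam) * gam a b.
  rewrite mulNr mulr_suml -sumrN; apply: eq_bigr => i _.
  rewrite big_split_ord /= big1 ?add0r => [|k _]; last by rewrite !chrE mulr0.
  under eq_bigr do rewrite !chrE mulrCA eq_sym.
  by rewrite sum_deltal mulNr s1.
have -> : \sum_e \sum_s chr (R e) (R a) s * chr s (R e) (R b) =
   \sum_e \sum_s chr2 e a s * chr2 s e b - (\sum_k grad1 lam k * D (L k) lam) * gam a b.
  under eq_bigr do rewrite big_split_ord /= addrC.
  rewrite big_split /=; congr (_ + _).
    by do 2!apply: eq_bigr => ? _; rewrite !chrE.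
  rewrite exchange_big mulr_suml -sumrN; apply: eq_bigr => k _ /=.
  under eq_bigr do rewrite !chrE eq_sym -mulrA.
  by rewrite sum_deltal mulrN mulrC s1.
rewrite ctrR; ring.
Qed.

(** * Derivatives of a block diagonal tensor with blocks [P] and [mu *: gam] *)

Section BlockTensor.
Variables (T : 'M[A]_(m1 + m2)) (P : 'M[A]_m1) (mu nu : A).
Hypotheses (TLL : forall i j, T (L i) (L j) = P i j).
Hypotheses (TLR : forall i a, T (L i) (R a) = 0) (TRL : forall i a, T (R a) (L i) = 0).
Hypotheses (TRR : forall a b, T (R a) (R b) = mu * gam a b).
Hypotheses (mu_nu : mu = lam ^+ 2 * nu) (nuR : forall a, D (R a) nu = 0).
Local Notation covT := (fcov D W Wi h T).

Lemma muR a : D (R a) mu = 0.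
Proof. by rewrite mu_nu (derM (der _)) D_lam2 (wd_lamR wd) nuR; ring. Qed.

Lemma covLLL k i j : covT (L k) (L i) (L j) = cov1 P k i j.
Proof.
rewrite /fcov big_split_ord /= [X in _ - (_ + X)]big1 => [|a _].
  rewrite addr0 TLL; congr (_ - _); apply: eq_bigr => m _.
  by rewrite !TLL !chrE.
by rewrite TLR TRL !mulr0 addr0.
Qed.

(** The fibre block is [nu] times the fibre block of the metric, and the metric is parallel, so only
    [nu] is differentiated. *)
Lemma covLRR k a b : covT (L k) (R a) (R b) = lam ^+ 2 * D (L k) nu * gam a b.
Proof.
rewrite /fcov big_split_ord /= big1 ?add0r => [|m _]; last first.
  by rewrite TLR TRL !mulr0 addr0.
rewrite big_split /=.
under eq_bigr do rewrite !chrE eq_sym -mulrA.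
under [X in _ - (_ + X)]eq_bigr do rewrite !chrE eq_sym -mulrA.
rewrite !sum_deltal !TRR (derM (der _)) (wd_gamL wd) mu_nu (derM (der _)) D_lam2.
transitivity (lam ^+ 2 * D (L k) nu * gam a b
  + 2 * lam * D (L k) lam * nu * gam a b * (1 - lam * lami)); first ring.
by rewrite (wd_lam wd) subrr mulr0 addr0.
Qed.

(** Coefficient of the mixed component of the covariant derivative in a fibre direction. [P] is not
    assumed symmetric, hence the primed variant; both have the same contraction with grad lam. *)
Definition mixed_slope i := lam * (\sum_k grad1 lam k * P i k) - lami * D (L i) lam * mu.
Definition mixed_slope' i := lam * (\sum_k grad1 lam k * P k i) - lami * D (L i) lam * mu.

Lemma covRLR a i b : covT (R a) (L i) (R b) = mixed_slope i * gam a b.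
Proof.
rewrite /fcov big_split_ord /= TLR D0.
have -> : \sum_m (chr (L m) (R a) (L i) * T (L m) (R b) + chr (L m) (R a) (R b) * T (L i) (L m))
    = - (lam * (\sum_k grad1 lam k * P i k) * gam a b).
  rewrite mulr_sumr mulr_suml -sumrN; apply: eq_bigr => m _.
  by rewrite !chrE TLR TLL; ring.
have -> : \sum_e (chr (R e) (R a) (L i) * T (R e) (R b) + chr (R e) (R a) (R b) * T (L i) (R e))
    = lami * D (L i) lam * mu * gam a b.
  under eq_bigr do rewrite !chrE TLR mulr0 addr0 eq_sym -mulrA.
  by rewrite sum_deltal TRR mulrA.
rewrite /mixed_slope; ring.
Qed.

Lemma covRRL a b i : covT (R a) (R b) (L i) = mixed_slope' i * gam a b.
Proof.
rewrite /fcov big_split_ord /= TRL D0.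
have -> : \sum_m (chr (L m) (R a) (R b) * T (L m) (L i) + chr (L m) (R a) (L i) * T (R b) (L m))
    = - (lam * (\sum_k grad1 lam k * P k i) * gam a b).
  rewrite mulr_sumr mulr_suml -sumrN; apply: eq_bigr => m _.
  by rewrite !chrE TRL TLL; ring.
have -> : \sum_e (chr (R e) (R a) (R b) * T (R e) (L i) + chr (R e) (R a) (L i) * T (R b) (R e))
    = lami * D (L i) lam * mu * gam a b.
  under eq_bigr do rewrite !chrE TRL mulr0 add0r eq_sym -mulrA.
  by rewrite sum_deltal TRR mulrA (G_sym fm2 b).
rewrite /mixed_slope'; ring.
Qed.

Lemma covRRR a b e : covT (R a) (R b) (R e) = 0.
Proof.
rewrite /fcov big_split_ord /= big1 ?add0r => [|m _]; last first.
  by rewrite !TLR !TRL !mulr0 addr0.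
rewrite TRR (derM (der _)) muR mul0r add0r.
have /matrixP/(_ b e) := compat fm2 a; rewrite !mxE => ->.
rewrite mulrDr !mulr_sumr -big_split /= -sumrB big1 // => f _.
by rewrite !TRR !chrE !mxE; ring.
Qed.

Lemma cov2LL k l a b : cov2 T (L k) (L l) (R a) (R b) =
  lam ^+ 2 * hess1 nu k l * gam a b.
Proof.
rewrite /fcov2 big_split_ord /= covLRR.
have -> : \sum_m (chr (L m) (L k) (L l) * covT (L m) (R a) (R b)
   + chr (L m) (L k) (R a) * covT (L l) (L m) (R b)
   + chr (L m) (L k) (R b) * covT (L l) (R a) (L m))
   = lam ^+ 2 * gam a b * \sum_m chr1 m k l * D (L m) nu.
  rewrite mulr_sumr; apply: eq_bigr => m _.
  by rewrite covLRR !chrE; ring.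
have -> : \sum_e (chr (R e) (L k) (L l) * covT (R e) (R a) (R b)
   + chr (R e) (L k) (R a) * covT (L l) (R e) (R b)
   + chr (R e) (L k) (R b) * covT (L l) (R a) (R e))
   = 2 * (lami * D (L k) lam * (lam ^+ 2 * D (L l) nu) * gam a b).
  transitivity (\sum_e (a == e)%:R * (lami * D (L k) lam * (lam ^+ 2 * D (L l) nu) * gam e b)
     + \sum_e (b == e)%:R * (lami * D (L k) lam * (lam ^+ 2 * D (L l) nu) * gam a e)).
    rewrite -big_split; apply: eq_bigr => e _ /=.
    by rewrite !covLRR !chrE ![e == _]eq_sym; ring.
  by rewrite !sum_deltal; ring.
rewrite !(derM (der _)) (wd_gamL wd) /fhess.
transitivity (lam ^+ 2 * (D (L k) (D (L l) nu) - \sum_m chr1 m k l * D (L m) nu) * gam a b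
  + 2 * lam * D (L k) lam * D (L l) nu * gam a b * (1 - lam * lami)); first ring.
by rewrite (wd_lam wd) subrr mulr0 addr0.
Qed.

(** First derivatives with all indices in the fibre vanish by [covRRR]; what survives are the
    corrections through the second fundamental form [chrLRR], one for each of the three lower
    indices. *)
Lemma cov2RR (e f a b : 'I_m2) : cov2 T (R e) (R f) (R a) (R b) =
  lam ^+ 3 * dot1 lam nu * gam e f * gam a b
  + lam * (\sum_m grad1 lam m * mixed_slope m) * gam e a * gam f b
  + lam * (\sum_m grad1 lam m * mixed_slope' m) * gam e b * gam f a.
Proof.
rewrite /fcov2 big_split_ord /= covRRR D0.
rewrite [X in _ - (_ + X)]big1 => [|c _]; last by rewrite !covRRR !mulr0 !addr0.
rewrite addr0 sub0r (fdotE fm1) !mulr_sumr !mulr_suml -!big_split -sumrN.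
apply: eq_bigr => m _ /=.
by rewrite covLRR covRLR covRRL !chrE; ring.
Qed.

Definition tensor_on_grad := \sum_k \sum_l grad1 lam k * P k l * grad1 lam l.

Lemma grad_mixed : \sum_m grad1 lam m * mixed_slope m =
  lam * tensor_on_grad - lami * dot1 lam lam * mu.
Proof.
rewrite (fdotE fm1) /tensor_on_grad !mulr_sumr mulr_suml -sumrB.
apply: eq_bigr => m _; rewrite /mixed_slope mulrBr !mulr_sumr; congr (_ - _).
  by apply: eq_bigr => l _; ring.
ring.
Qed.

Lemma grad_mixed' : \sum_m grad1 lam m * mixed_slope' m =
  lam * tensor_on_grad - lami * dot1 lam lam * mu.
Proof.
rewrite (fdotE fm1) /tensor_on_grad exchange_big !mulr_sumr mulr_suml -sumrB.
apply: eq_bigr => m _; rewrite /mixed_slope' mulrBr !mulr_sumr; congr (_ - _).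
  by apply: eq_bigr => l _; ring.
ring.
Qed.

Lemma sum_gam_trace : \sum_a \sum_b gami a b * gam a b = m2%:R.
Proof.
rewrite -[RHS]mulr1 mulr_natl -[m2 in RHS]card_ord -sumr_const; apply: eq_bigr => a _.
under eq_bigr do rewrite (G_sym fm2).
by rewrite (sum_GiG fm2) eqxx.
Qed.

Lemma sum_gam_contract a b : \sum_e \sum_f gami e f * gam e a * gam f b = gam a b.
Proof.
rewrite -[RHS](sum_delta (fun e => gam e b)) exchange_big; apply: eq_bigr => f _ /=.
rewrite -(sum_GiG fm2) mulr_suml; apply: eq_bigr => e _.
by rewrite (Gi_sym fm2 e).
Qed.

(** Base directions contribute Lap nu. In the trace of [cov2RR] over the fibre, the first term gets
    the factor m2 and each of the two mixed terms the factor 1. *)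
Lemma flaplacianRR a b : flaplacian D W Wi h T (R a) (R b) =
  (lam ^+ 2 * lap1 nu + m2%:R * lam * dot1 lam nu
   + 2 * (tensor_on_grad - nu * dot1 lam lam)) * gam a b.
Proof.
rewrite mxE big_split_ord /=.
have -> : \sum_i \sum_s Wi (L i) s * cov2 T (L i) s (R a) (R b) =
    lam ^+ 2 * lap1 nu * gam a b.
  rewrite /flap mulr_sumr mulr_suml; apply: eq_bigr => k _.
  rewrite big_split_ord /= [X in _ + X]big1 => [|e _]; last by rewrite WE mul0r.
  rewrite addr0 mulr_sumr mulr_suml; apply: eq_bigr => l _.
  by rewrite cov2LL WE; ring.
have -> : \sum_e \sum_s Wi (R e) s * cov2 T (R e) s (R a) (R b) =
    lami ^+ 2 * (lam ^+ 3 * dot1 lam nu * gam a b * (\sum_e \sum_f gami e f * gam e f)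
    + lam * (\sum_m grad1 lam m * mixed_slope m)
        * (\sum_e \sum_f gami e f * gam e a * gam f b)
    + lam * (\sum_m grad1 lam m * mixed_slope' m)
        * (\sum_e \sum_f gami e f * gam e b * gam f a)).
  have r e (f : 'I_m2) := cov2RR e f a b.
  move: (\sum_m grad1 lam m * mixed_slope m) (\sum_m grad1 lam m * mixed_slope' m) r.
  move: (dot1 lam nu) => Z X Y r.
  rewrite mulrDr mulrDr !mulr_sumr -!big_split; apply: eq_bigr => e _ /=.
  rewrite big_split_ord /= [V in V + _]big1 => [|k _]; last by rewrite WE mul0r.
  rewrite add0r !mulr_sumr -!big_split; apply: eq_bigr => f _ /=.
  by rewrite r WE; ring.
rewrite sum_gam_trace !sum_gam_contract grad_mixed grad_mixed' (G_sym fm2 b a).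
have e2 : lami ^+ 2 * lam ^+ 2 = 1 by rewrite -exprMn mulrC (wd_lam wd) expr1n.
have -> : mu = lam ^+ 2 * nu by [].
transitivity (lam ^+ 2 * lap1 nu * gam a b + (lami ^+ 2 * lam ^+ 2) * (
  m2%:R * lam * dot1 lam nu + 2 * (tensor_on_grad - (lam * lami) * nu * dot1 lam lam)) * gam a b).
  ring.
rewrite e2 (wd_lam wd); ring.
Qed.

Lemma fdivL j : fdiv D W Wi h T (L j) =
  fdiv d1 g gi h P j + m2%:R * lami ^+ 2 * mixed_slope j.
Proof.
rewrite /fdiv big_split_ord /=; congr (_ + _).
  apply: eq_bigr => k _; rewrite big_split_ord /= [X in _ + X]big1 => [|e _].
    by rewrite addr0; apply: eq_bigr => l _; rewrite covLLL WE.
  by rewrite WE mul0r.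
rewrite -sum_gam_trace !mulr_suml; apply: eq_bigr => e _.
rewrite big_split_ord /= big1 => [|k _]; last by rewrite WE mul0r.
by rewrite add0r !mulr_suml; apply: eq_bigr => f _; rewrite covRLR WE; ring.
Qed.

Lemma ftraceE : ftrace Wi T = ftrace gi P + m2%:R * nu.
Proof.
rewrite /ftrace big_split_ord /=; congr (_ + _).
  apply: eq_bigr => k _; rewrite big_split_ord /= [X in _ + X]big1 => [|e _].
    by rewrite addr0; apply: eq_bigr => l _; rewrite TLL WE.
  by rewrite WE mul0r.
rewrite -sum_gam_trace !mulr_suml; apply: eq_bigr => e _.
rewrite big_split_ord /= big1 => [|k _]; last by rewrite WE mul0r.
rewrite add0r !mulr_suml; apply: eq_bigr => f _; rewrite TRR WE mu_nu.
by rewrite -[RHS]lami2; ring.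
Qed.

End BlockTensor.

(** * The Ricci tensor of the warped metric and the variation of its fibre coefficient *)

Section RicciTensor.
Variable c : A.
Hypotheses (cD : forall s, D s c = 0) (einst : forall a b, ric2 a b = c * gam a b).

Definition ric_mu := c - (lam * lap1 lam + (m2%:R - 1) * dot1 lam lam).
Definition ric_nu := lami ^+ 2 * ric_mu.
Definition ric_base : 'M[A]_m1 :=
  \matrix_(i, j) (ric1 i j - m2%:R * lami * hess1 lam i j).
Local Notation mu := ric_mu.
Local Notation nu := ric_nu.
Local Notation P := ric_base.
Local Notation Q := (tensor_on_grad P).

Lemma ricRR_mu a b : ric (R a) (R b) = mu * gam a b.
Proof. by rewrite ricRR einst /ric_mu; ring. Qed.

Lemma ric_baseE i j : ric (L i) (L j) = P i j.
Proof. by rewrite ricLL [RHS]mxE. Qed.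

Lemma ric_mu_nu : mu = lam ^+ 2 * nu.
Proof.
by rewrite /ric_nu mulrA -exprMn (wd_lam wd) expr1n mul1r.
Qed.

Lemma hess1R a k l : D (R a) (hess1 lam k l) = 0.
Proof.
have r := wd_lamR wd a.
rewrite (derB (der _)) (der_sum (der _)) big1 ?subr0 => [|m _].
  by rewrite !D_R_L.
by rewrite (derM (der _)) chr1R (D_R_L _ r); ring.
Qed.

Lemma ric_muR a : D (R a) mu = 0.
Proof.
have r := wd_lamR wd a.
have dd : D (R a) (dot1 lam lam) = 0.
  rewrite (fdotE fm1) (der_sum (der _)) big1 // => k _.
  by rewrite (derM (der _)) (gradR _ r) (D_R_L _ r); ring.
have dl : D (R a) (lap1 lam) = 0.
  rewrite (der_sum (der _)) big1 // => k _; rewrite (der_sum (der _)) big1 // => l _.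
  by rewrite (derM (der _)) hess1R giR; ring.
rewrite /ric_mu; move: (dot1 lam lam) (lap1 lam) dd dl => X Y dd dl.
rewrite (derB (der _)) cD (derD (der _)) !(derM (der _)) r (derB (der _)).
by rewrite (der_nat (der _)) (der1 (der _)) dd dl; ring.
Qed.

Lemma ric_nuR a : D (R a) nu = 0.
Proof. by rewrite /ric_nu (derM (der _)) ric_muR expr2 (derM (der _)) lamiR; ring. Qed.

Lemma laplacian_ric a b : flaplacian D W Wi h ric (R a) (R b) =
  (lam ^+ 2 * lap1 nu + m2%:R * lam * dot1 lam nu
   + 2 * (Q - nu * dot1 lam lam)) * gam a b.
Proof.
exact: (flaplacianRR ric_baseE ricLR (fun i a => ricRL i a) ricRR_mu ric_mu_nu ric_nuR).
Qed.

(** [P] is not the Ricci tensor of [g], so the identity is taken from the total space and the fibre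
    contributions are moved to the right. The left side is the combination that the variation of the
    Laplacian contains. *)
Lemma base_bianchi j : 2 * fdiv d1 g gi h P j - D (L j) (ftrace gi P) =
  m2%:R * D (L j) nu - 2 * m2%:R * lami ^+ 2 * mixed_slope P mu j.
Proof.
have := contracted_bianchi fm (L j).
rewrite (fdivL ric_baseE ricLR ricRL ricRR_mu).
rewrite (ftraceE ric_baseE ricRR_mu ric_mu_nu) (derD (der _)) DnatM => e.
rewrite -[m2%:R * _](addKr (D (L j) (ftrace gi P))) -e; ring.
Qed.

(** Velocity of [ric_mu] when [g] moves with velocity [T], [lam] with velocity [v], and [c] is
    fixed. *)
Definition mu_var (T : 'M[A]_m1) v :=
  - (v * lap1 lam + lam * flap_var d1 g gi h T lam v
     + (m2%:R - 1) * fdot_var d1 gi T lam v).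

Lemma dt_mu dt : derivation dt -> (forall s f, dt (D s f) = D s (dt f)) ->
  dt c = 0 -> dt mu = mu_var (map_mx dt g) (dt lam).
Proof.
move=> dtD dtC dtc.
rewrite /mu_var -(dt_flap fm1 dtD) // -(dt_fdot fm1 dtD) // /ric_mu.
move: (lap1 lam) (dot1 lam lam) => X Y.
rewrite (derB dtD) dtc (derD dtD) !(derM dtD) (derB dtD) (der_nat dtD) (der1 dtD); ring.
Qed.

Lemma fcovZ n T k i j : (forall s, D s n = 0) ->
  fcov d1 g gi h (n *: T) k i j = n * cov1 T k i j.
Proof.
move=> nD; rewrite /fcov mxE (derM (der _)) nD mul0r add0r mulrBr mulr_sumr.
by congr (_ - _); apply: eq_bigr => m _; rewrite !mxE; ring.
Qed.

Lemma mu_var_flow : mu_var (- 2 *: P) (- (lam * nu)) =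
  lam ^+ 2 * lap1 nu + m2%:R * lam * dot1 lam nu + 2 * (Q - nu * dot1 lam lam)
  + 2 * lam * nu * lap1 lam
  - 2 * lam * \sum_k \sum_l (\sum_p \sum_q gi k p * gi l q * P p q) * hess1 lam k l.
Proof.
have d2 s : D s (- 2) = 0 by rewrite (derN (der _)) (der_nat (der _)) oppr0.
have sT k l : \sum_p \sum_q gi k p * gi l q * (- 2 *: P) p q =
    - 2 * \sum_p \sum_q gi k p * gi l q * P p q.
  rewrite mulr_sumr; apply: eq_bigr => p _; rewrite mulr_sumr.
  by apply: eq_bigr => q _; rewrite mxE; ring.
have divT l : fdiv d1 g gi h (- 2 *: P) l = - 2 * fdiv d1 g gi h P l.
  rewrite /fdiv mulr_sumr; apply: eq_bigr => k _; rewrite mulr_sumr.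
  by apply: eq_bigr => m _; rewrite fcovZ //; ring.
have trT : ftrace gi (- 2 *: P) = - 2 * ftrace gi P.
  rewrite /ftrace mulr_sumr; apply: eq_bigr => k _; rewrite mulr_sumr.
  by apply: eq_bigr => m _; rewrite mxE; ring.
(* The term from the variation of the connection; the Bianchi identity removes the derivatives of
   [P] and leaves the derivative of [nu] and zero-order terms in [P] and [mu]. *)
have div_term : \sum_l (fdiv d1 g gi h (- 2 *: P) l - h * D (L l) (ftrace gi (- 2 *: P)))
     * grad1 lam l = 2 * m2%:R * lami ^+ 2 * (lam * Q - lami * dot1 lam lam * mu)
   - m2%:R * dot1 lam nu.
  rewrite -(grad_mixed P mu) (fdotE fm1) !mulr_sumr -sumrB; apply: eq_bigr => l _.
  rewrite divT trT (derM (der _)) d2 mul0r add0r.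
  transitivity (- (2 * fdiv d1 g gi h P l - h * 2 * D (L l) (ftrace gi P)) * grad1 lam l).
    ring.
  by rewrite h2 mul1r base_bianchi; ring.
have quad : \sum_k \sum_l (\sum_p \sum_q gi k p * gi l q * P p q) * (D (L k) lam * D (L l) lam)
    = Q.
  under eq_bigr do under eq_bigr do (rewrite mulr_suml;
    under eq_bigr do rewrite mulr_suml).
  under eq_bigr do rewrite exchange_big /=.
  rewrite exchange_big; apply: eq_bigr => p _ /=.
  under eq_bigr do rewrite exchange_big /=.
  rewrite exchange_big; apply: eq_bigr => q _ /=.
  rewrite /fgrad !mulr_suml; apply: eq_bigr => k _; rewrite mulr_sumr.
  by apply: eq_bigr => l _; rewrite (Gi_sym fm1 k p) (Gi_sym fm1 l q); ring.
rewrite /mu_var.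
have -> : fdot_var d1 gi (- 2 *: P) lam (- (lam * nu)) = - 2 * dot1 lam (lam * nu) + 2 * Q.
  have dN : dot1 lam (- (lam * nu)) = - dot1 lam (lam * nu).
    rewrite /fdot -sumrN; apply: eq_bigr => k _; rewrite -sumrN; apply: eq_bigr => l _.
    by rewrite (derN (der _)) mulrN.
  have S1 : \sum_k \sum_l (\sum_p \sum_q gi k p * gi l q * (- 2 *: P) p q)
      * (D (L k) lam * D (L l) lam) = - 2 * Q.
    rewrite -quad mulr_sumr; apply: eq_bigr => k _; rewrite mulr_sumr.
    by apply: eq_bigr => l _; rewrite sT; ring.
  rewrite /fdot_var S1 dN; move: (dot1 _ _) => X; ring.
have -> : flap_var d1 g gi h (- 2 *: P) lam (- (lam * nu)) = - lap1 (lam * nu)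
   + 2 * (\sum_k \sum_l (\sum_p \sum_q gi k p * gi l q * P p q) * hess1 lam k l)
   - (2 * m2%:R * lami ^+ 2 * (lam * Q - lami * dot1 lam lam * mu) - m2%:R * dot1 lam nu).
  rewrite /flap_var div_term; congr (_ + _ - _).
    rewrite /flap -sumrN; apply: eq_bigr => k _; rewrite -sumrN; apply: eq_bigr => l _.
    rewrite -[RHS]mulrN /fhess opprB [in RHS]addrC; congr (_ * (_ + _)).
      by rewrite !(derN (der _)).
    by rewrite -sumrN; apply: eq_bigr => m _; rewrite (derN (der _)) mulrN opprK.
  rewrite mulr_sumr -sumrN; apply: eq_bigr => k _.
  rewrite mulr_sumr -sumrN; apply: eq_bigr => l _; rewrite sT.
  by move: (\sum_p _) => X; ring.
rewrite ric_mu_nu (flapM fm1) (fdotMr fm1).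
move: (\sum_k _) => S.
move: nu Q (lap1 nu) (lap1 lam) (dot1 lam nu) (dot1 lam lam) => v q lv ll dv dl.
have e : lam * lami = 1 := wd_lam wd.
(* Once [lam * lami] is 1, the coefficient of [q] is 2 m2 - 2 (m2 - 1) = 2 and that of [v * dl] is 2
   (m2 - 1) - 2 m2 = -2, as in the Laplacian. *)
transitivity (lam ^+ 2 * lv + (2 * m2%:R * (lam * lami) ^+ 2 - 2 * (m2%:R - 1)) * q
   + m2%:R * lam * dv
   + (2 * (m2%:R - 1) - 2 * m2%:R * (lam * lami) ^+ 3) * v * dl
   + 2 * lam * v * ll - 2 * lam * S); first ring.
by rewrite e; ring.
Qed.

End RicciTensor.

End WarpedProduct.

Local Open Scope classical_set_scope.
Local Open Scope ring_scope.

(** * Calculus of [Ck] functions *)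

Section CkCalculus.
Context {R : realType} {V : normedModType R}.
Implicit Types (U : set V) (f g : V -> R) (v x : V) (k : nat).

Lemma CkS {W : normedModType R} k U (f : V -> W) : Ck k.+1 U f -> Ck k U f.
Proof.
elim: k f => [|k IH] f [c D]; first by split.
split=> // v; have [d Df] := D v; split=> //; exact: IH.
Qed.

Lemma Ck_subset {W : normedModType R} k U U' (f : V -> W) :
  U' `<=` U -> Ck k U f -> Ck k U' f.
Proof.
move=> UU; elim: k f => [|k IH] f [c D]; first by split=> // x /UU; exact: c.
split=> [x /UU|v]; first exact: c.
have [d Df] := D v; split=> [x /UU|]; [exact: d|exact: IH].
Qed.

Lemma Ck_cst k U (a : R) : Ck k U (fun=> a).
Proof.
elim: k a => [|k IH] a; first by split=> // x _; exact: cst_continuous.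
split=> [x _|v]; first exact: cst_continuous.
split=> [x _|]; first exact: derivable_cst.
have -> : 'D_v (fun=> a) = (fun=> 0) :> (V -> R) by apply/funext => x; exact: derive_cst.
exact: IH.
Qed.

Lemma CkD k U f g : open U -> Ck k U f -> Ck k U g -> Ck k U (fun x => f x + g x).
Proof.
move=> oU; elim: k f g => [|k IH] f g [cf Df] [cg Dg].
  by split=> // x Ux; apply: cvgD; [exact: cf|exact: cg].
split=> [x Ux|v]; first by apply: cvgD; [exact: cf|exact: cg].
have [[df D2f] [dg D2g]] := (Df v, Dg v); split=> [x Ux|].
  by apply: derivableD; [exact: df|exact: dg].
apply: Ck_ext oU _ (IH _ _ D2f D2g) => x Ux.
by rewrite deriveD; [|exact: df|exact: dg].
Qed.

Lemma CkN k U f : open U -> Ck k U f -> Ck k U (fun x => - f x).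
Proof.
move=> oU; elim: k f => [|k IH] f [cf Df].
  by split=> // x Ux; apply: cvgN; exact: cf.
split=> [x Ux|v]; first by apply: cvgN; exact: cf.
have [df D2f] := Df v; split=> [x Ux|]; first by apply: derivableN; exact: df.
apply: Ck_ext oU _ (IH _ D2f) => x Ux.
by rewrite deriveN //; exact: df.
Qed.

Lemma CkM k U f g : open U -> Ck k U f -> Ck k U g -> Ck k U (fun x => f x * g x).
Proof.
move=> oU; elim: k f g => [|k IH] f g.
  by move=> [cf Df] [cg Dg]; split=> // x Ux; apply: cvgM; [exact: cf|exact: cg].
move=> /[dup] /CkS f0 [cf Df] /[dup] /CkS g0 [cg Dg].
split=> [x Ux|v]; first by apply: cvgM; [exact: cf|exact: cg].
have [[df D2f] [dg D2g]] := (Df v, Dg v); split=> [x Ux|].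
  by apply: derivableM; [exact: df|exact: dg].
apply: Ck_ext oU _ (CkD oU (IH _ _ f0 D2g) (IH _ _ g0 D2f)) => x Ux.
by rewrite deriveM; [|exact: df|exact: dg].
Qed.

Lemma CkV k U f : open U -> (forall x, U x -> f x != 0) ->
  Ck k U f -> Ck k U (fun x => (f x)^-1).
Proof.
move=> oU f0; elim: k => [|k IH].
  by move=> [cf Df]; split=> // x Ux; apply: cvgV; [exact: f0|exact: cf].
move=> /[dup] /CkS /IH Cf [cf Df].
split=> [x Ux|v]; first by apply: cvgV; [exact: f0|exact: cf].
have [df D2f] := Df v; split=> [x Ux|].
  by apply: derivableV; [exact: f0|exact: df].
apply: Ck_ext oU _ (CkN oU (CkM oU (CkM oU Cf Cf) D2f)) => x Ux.
rewrite deriveV; [|exact: f0|exact: df].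
by rewrite /GRing.scale /= expr2 invfM mulNr.
Qed.

Lemma Ck_derive k U f v : Ck k.+1 U f -> Ck k U ('D_v f).
Proof. by move=> [_ /(_ v)[]]. Qed.

End CkCalculus.

Lemma Ck_precomp {R : realType} {V V' W : normedModType R} (L : V -> V')
    k (U : set V') (f : V' -> W) :
  continuous L -> linear L -> Ck k U f -> Ck k (L @^-1` U) (f \o L).
Proof.
move=> cL lL; have LD h v x : L (h *: v + x) = h *: L v + L x by exact: lL.
elim: k f => [|k IH] f [cf Df].
  by split=> // x Ux; apply: continuous_comp; [exact: cL|exact: cf].
split=> [x Ux|v]; first by apply: continuous_comp; [exact: cL|exact: cf].
have [df D2f] := Df (L v); split=> [x Ux|].
  rewrite /derivable; under eq_fun do rewrite /= LD.
  exact: df.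
have -> : 'D_v (f \o L) = 'D_(L v) f \o L.
  apply/funext => x; rewrite /derive /=; congr lim.
  by under eq_fun do rewrite /= LD.
exact: IH.
Qed.

Lemma Ck_entry {R : realType} {V : normedModType R} m n k (U : set V)
    (F : V -> 'M[R]_(m, n)) i j :
  open U -> Ck k U F -> Ck k U (fun x => F x i j).
Proof.
move=> oU; elim: k F => [|k IH] F [cF DF].
  split=> // x Ux; apply: (@continuous_comp _ _ _ F (fun M => M i j)).
    exact: cF.
  exact: coord_continuous.
split=> [x Ux|v].
  apply: (@continuous_comp _ _ _ F (fun M => M i j)); first exact: cF.
  exact: coord_continuous.
have [dF D2F] := DF v; split=> [x Ux|].
  by have /derivable_mxP := dF x Ux.
apply: Ck_ext oU _ (IH _ D2F) => x Ux; rewrite derive_mx ?mxE //; exact: dF.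
Qed.

(** * Symmetry of second derivatives *)

Section Schwarz.
Context {R : realType} {V : normedModType R}.
Implicit Types (U : set V) (f : V -> R) (u v x y : V).

Lemma is_derive_line f u y (s : R) : derivable f (s *: u + y) u ->
  is_derive s 1 (fun r : R => f (r *: u + y)) ('D_u f (s *: u + y)).
Proof.
move=> df.
have e : (fun h : R => h^-1 *: (f ((h *: 1 + s) *: u + y) - f (s *: u + y))) =
    (fun h => h^-1 *: (f (h *: u + (s *: u + y)) - f (s *: u + y))).
  by apply/funext => h; rewrite scalerDl addrA /GRing.scale /= mulr1.
split; first by rewrite /derivable e.
by rewrite /derive; congr lim; rewrite e.
Qed.

Lemma MVT_from0 (f df : R -> R) (h : R) : 0 < h ->
  (forall s, s \in `[0, h] -> is_derive s 1 f (df s)) ->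
  exists2 s, s \in `[0, h] & f h - f 0 = df s * h.
Proof.
move=> h0 fd.
have cf : {within `[0, h], continuous f}.
  apply: derivable_within_continuous => s si.
  by have [] := fd s si.
have fd' s : s \in `]0, h[ -> is_derive s 1 f (df s).
  by rewrite in_itv /= => /andP[/ltW s0 /ltW sh]; apply: fd; rewrite in_itv /= s0.
have [s si e] := @MVT_segment R f df 0 h (ltW h0) fd' cf.
by exists s; rewrite // -[h in RHS]subr0.
Qed.

(* Mean value theorem applied twice: the second difference of [f] along [u]  *)
(* and [v] is the product of the steps and a mixed second derivative.        *)
Lemma second_difference U f u v x (h : R) : 0 < h ->
  (forall s r : R, s \in `[0, h] -> r \in `[0, h] -> U (s *: u + (r *: v + x))) ->
  Ck 2 U f -> exists s r : R, [/\ s \in `[0, h], r \in `[0, h] &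
    f (h *: u + (h *: v + x)) - f (h *: u + x) - f (h *: v + x) + f x =
    'D_v ('D_u f) (s *: u + (r *: v + x)) * (h * h)].
Proof.
move=> h0 hU [cf Df]; have [df [cDf DDf]] := Df u; have [ddf _] := DDf v.
have i0 : 0 \in `[0, h] by rewrite in_itv /= lexx ltW.
have ih : h \in `[0, h] by rewrite in_itv /= lexx ltW.
pose phi (s : R) := f (s *: u + (h *: v + x)) - f (s *: u + (0 *: v + x)).
have dphi s : s \in `[0, h] ->
    is_derive s 1 phi ('D_u f (s *: u + (h *: v + x)) - 'D_u f (s *: u + (0 *: v + x))).
  move=> si; apply: is_deriveB; apply: is_derive_line; apply: df; exact: hU.
have [s si es] := MVT_from0 h0 dphi.
pose psi (r : R) := 'D_u f (r *: v + (s *: u + x)).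
have dpsi r : r \in `[0, h] -> is_derive r 1 psi ('D_v ('D_u f) (r *: v + (s *: u + x))).
  by move=> ri; apply: is_derive_line; apply: ddf; rewrite addrCA; exact: hU.
have [r ri er] := MVT_from0 h0 dpsi.
exists s, r; split=> //; rewrite [s *: u + _]addrCA mulrA -er.
have -> : psi h - psi 0 = 'D_u f (s *: u + (h *: v + x)) - 'D_u f (s *: u + (0 *: v + x)).
  by rewrite /psi ![s *: u + (_ + x)]addrCA.
by rewrite -es /phi !scale0r !add0r; ring.
Qed.

Lemma nbhs_parallelogram (B : set V) u v x : nbhs x B -> exists2 h : R, 0 < h &
  forall s r : R, s \in `[0, h] -> r \in `[0, h] -> B (s *: u + (r *: v + x)).
Proof.
move=> /nbhs_ballP [e /= e0 eB].
have n0 : 0 < `|u| + `|v| + 1 by rewrite ltr_wpDl // addr_ge0.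
(* The summand 1 keeps the denominator positive when [u] and [v] vanish and makes the final estimate
   strict. *)
exists (e / (`|u| + `|v| + 1)); first exact: divr_gt0.
set h := e / _; have h0 : 0 < h by exact: divr_gt0.
move=> s r; rewrite !in_itv /= => /andP[s0 sh] /andP[r0 rh].
apply: eB; rewrite -ball_normE /ball_ /= addrA opprD addrCA subrr addr0 normrN.
apply: (le_lt_trans (ler_normD _ _)); rewrite !normrZ (ger0_norm s0) (ger0_norm r0).
apply: (@le_lt_trans _ _ (h * (`|u| + `|v|))).
  by rewrite mulrDr lerD // ler_wpM2r.
by rewrite -[ltRHS](divfK (lt0r_neq0 n0)) -/h ltr_pM2l // ltrDl.
Qed.

(** The second difference is symmetric in [u] and [v], so the two mixed derivatives agree when taken
    at suitable points of a small parallelogram; by continuity each is within e / 2 of its value at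
    [x]. *)
Lemma schwarz U f u v x : open U -> U x -> Ck 2 U f ->
  'D_u ('D_v f) x = 'D_v ('D_u f) x.
Proof.
move=> oU Ux Cf; have [cf Df] := Cf.
have cuv w w' : {for x, continuous ('D_w ('D_w' f))}.
  by have [_ [_ /(_ w) [_ [c _]]]] := Df w'; exact: c.
have nU : nbhs x U by exact: open_nbhs_nbhs.
apply/eqP; rewrite -subr_eq0 -normr_le0; apply/ler_addgt0Pl => e e0; rewrite addr0.
have e2 : 0 < e / 2 by rewrite divr_gt0.
have nB w w' : nbhs x [set y | `|'D_w ('D_w' f) x - 'D_w ('D_w' f) y| < e / 2].
  by have /cvgrPdist_lt /(_ _ e2) := cuv w w'.
have [h h0 hB] := nbhs_parallelogram u v (filterI nU (filterI (nB u v) (nB v u))).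
have [|s [r [si ri es]]] := @second_difference U f u v x h h0 _ Cf.
  by move=> s r si ri; have [] := hB s r si ri.
have [|r' [s' [ri' si' es']]] := @second_difference U f v u x h h0 _ Cf.
  by move=> s' r' si' ri'; rewrite addrCA; have [] := hB r' s' ri' si'.
have [_ [_ /= B1]] := hB s r si ri; have [_ [/= B2 _]] := hB s' r' si' ri'.
have hh : h * h != 0 by rewrite mulf_neq0 // gt_eqF.
have e1 : h *: v + (h *: u + x) = h *: u + (h *: v + x) by rewrite addrCA.
have e2' : s' *: u + (r' *: v + x) = r' *: v + (s' *: u + x) by rewrite addrCA.
rewrite e1 in es'; rewrite e2' in B2.
have close (a b c d p q t w : R) : p - q - t + w = c * (h * h) ->
    p - t - q + w = d * (h * h) -> `|a - d| < e / 2 -> `|b - c| < e / 2 ->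
    `|a - b| <= e.
  move=> ec ed da bc; have cd : c = d by apply: (mulIf hh); rewrite -ec -ed; ring.
  rewrite {}cd in bc; rewrite (splitr e) -(subrKA d); apply: (le_trans (ler_normD _ _)).
  by apply: lerD; [exact: ltW|rewrite distrC; exact: ltW].
exact: close es es' B2 B1.
Qed.

End Schwarz.

(** * The ring of smooth functions on an open set *)

(* Smooth functions on the open set [U], extended by [0] outside [U] so that *)
(* Leibniz equality is equality on [U].                                      *)
Definition smfun_pred (R : realType) (V : normedModType R) (U : set V)
    (oU : open U) : pred (V -> R) :=
  fun f => `[< (forall k, Ck k U f) /\ forall x, ~ U x -> f x = 0 >].

Record smfun (R : realType) (V : normedModType R) (U : set V) (oU : open U) :=
  SmFun { smfun_val :> V -> R; _ : smfun_pred oU smfun_val }.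

Section SmoothRing.
Context {R : realType} {V : normedModType R} {U : set V} {oU : open U}.
Local Notation A := (smfun oU).
Implicit Types (F G : A) (x v : V).

HB.instance Definition _ := [isSub for @smfun_val R V U oU].
HB.instance Definition _ := [Choice of smfun oU by <:].

Lemma smfun_Ck F k : Ck k U F.
Proof. by have /asboolP [] := valP F. Qed.

Lemma smfun_out F x : ~ U x -> F x = 0.
Proof. by have /asboolP [_] := valP F; exact. Qed.

Definition restr (f : V -> R) x : R := if `[< U x >] then f x else 0.

Lemma restr_subproof f : (forall k, Ck k U f) -> smfun_pred oU (restr f).
Proof.
move=> Cf; apply/asboolP; split=> [k|x nUx]; last by rewrite /restr asboolF.
by apply: Ck_ext oU _ (Cf k) => x Ux; rewrite /restr asboolT.
Qed.

Definition smfun_of f (Cf : forall k, Ck k U f) : A := SmFun (restr_subproof Cf).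

Lemma smfun_ofE f (Cf : forall k, Ck k U f) x : U x -> smfun_of Cf x = f x.
Proof. by move=> Ux; rewrite /= /restr asboolT. Qed.

Lemma smfun_eq F G : (forall x, U x -> F x = G x) -> F = G.
Proof.
move=> FG; apply/val_inj/funext => x; have [Ux|nUx] := pselect (U x).
  exact: FG.
by rewrite /= !smfun_out.
Qed.

Definition smfun0 : A := smfun_of (fun k => Ck_cst k U 0).
Definition smfun1 : A := smfun_of (fun k => Ck_cst k U 1).
Definition smfun_add F G : A := smfun_of (fun k => CkD oU (smfun_Ck F k) (smfun_Ck G k)).
Definition smfun_opp F : A := smfun_of (fun k => CkN oU (smfun_Ck F k)).
Definition smfun_mul F G : A := smfun_of (fun k => CkM oU (smfun_Ck F k) (smfun_Ck G k)).

Lemma smfun_addA : associative smfun_add.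
Proof. by move=> F G H; apply: smfun_eq => x Ux; rewrite !smfun_ofE // addrA. Qed.
Lemma smfun_addC : commutative smfun_add.
Proof. by move=> F G; apply: smfun_eq => x Ux; rewrite !smfun_ofE // addrC. Qed.
Lemma smfun_add0 : left_id smfun0 smfun_add.
Proof. by move=> F; apply: smfun_eq => x Ux; rewrite !smfun_ofE // add0r. Qed.
Lemma smfun_addN : left_inverse smfun0 smfun_opp smfun_add.
Proof. by move=> F; apply: smfun_eq => x Ux; rewrite !smfun_ofE // addNr. Qed.

HB.instance Definition _ :=
  GRing.isZmodule.Build (smfun oU) smfun_addA smfun_addC smfun_add0 smfun_addN.

Lemma smfun_mulA : associative smfun_mul.
Proof. by move=> F G H; apply: smfun_eq => x Ux; rewrite !smfun_ofE // mulrA. Qed.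
Lemma smfun_mulC : commutative smfun_mul.
Proof. by move=> F G; apply: smfun_eq => x Ux; rewrite !smfun_ofE // mulrC. Qed.
Lemma smfun_mul1 : left_id smfun1 smfun_mul.
Proof. by move=> F; apply: smfun_eq => x Ux; rewrite !smfun_ofE // mul1r. Qed.
Lemma smfun_mulD : left_distributive smfun_mul smfun_add.
Proof. by move=> F G H; apply: smfun_eq => x Ux; rewrite !smfun_ofE // mulrDl. Qed.

HB.instance Definition _ :=
  GRing.Zmodule_isComPzRing.Build (smfun oU) smfun_mulA smfun_mulC smfun_mul1 smfun_mulD.

Lemma smfun0E x : (0 : A) x = 0.
Proof. by rewrite /= /restr; case: ifP. Qed.

Lemma smfun1E x : U x -> (1 : A) x = 1.
Proof. by move=> Ux; rewrite smfun_ofE. Qed.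

Lemma smfunDE F G x : (F + G) x = F x + G x.
Proof. by rewrite /= /restr; case: asboolP => // nUx; rewrite !smfun_out // addr0. Qed.

Lemma smfunNE F x : (- F) x = - F x.
Proof. by rewrite /= /restr; case: asboolP => // nUx; rewrite smfun_out // oppr0. Qed.

Lemma smfunME F G x : (F * G) x = F x * G x.
Proof. by rewrite /= /restr; case: asboolP => // nUx; rewrite !smfun_out // mulr0. Qed.

Lemma smfun_natE n x : U x -> (n%:R : A) x = n%:R.
Proof.
move=> Ux; elim: n => [|n IH]; first exact: smfun0E.
by rewrite !mulrS smfunDE smfun1E // IH.
Qed.

Lemma smfun_sumE (I : Type) (r : seq I) (P : pred I) (F : I -> A) x :
  (\sum_(i <- r | P i) F i) x = \sum_(i <- r | P i) F i x.
Proof. exact: (big_morph (fun F : A => F x) (fun F G => smfunDE F G x) (smfun0E x)). Qed.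

Definition sder v F : A := smfun_of (fun k => Ck_derive v (smfun_Ck F k.+1)).

Lemma sderE v F x : U x -> sder v F x = 'D_v F x.
Proof. by move=> Ux; rewrite smfun_ofE. Qed.

Lemma smfun_near F (f : V -> R) x : U x -> (forall y, U y -> F y = f y) ->
  \near x, F x = f x.
Proof. by move=> Ux Ff; apply: filterS (open_nbhs_nbhs (conj oU Ux)) => y /Ff. Qed.

Lemma sder_derivation v : derivation (sder v).
Proof.
have df F x : U x -> derivable F x v by have [_ /(_ v) [d _]] := smfun_Ck F 1; exact: d.
split=> F G; apply: smfun_eq => x Ux.
  rewrite smfunDE !sderE // -deriveD; try exact: df.
  by apply: near_eq_derive; apply: smfun_near => // y _; rewrite smfunDE.
rewrite smfunDE !smfunME !sderE // addrC.
transitivity ('D_v ((F : V -> R) * G) x).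
  by apply: near_eq_derive; apply: smfun_near => // y _; rewrite smfunME.
by rewrite deriveM; [rewrite /GRing.scale /= [G x * _]mulrC | exact: df | exact: df].
Qed.

Lemma sder_comm u v F : sder u (sder v F) = sder v (sder u F).
Proof.
apply: smfun_eq => x Ux; rewrite (sderE u _ Ux) (sderE v _ Ux).
have e w w' : 'D_w (sder w' F) x = 'D_w ('D_w' F) x.
  by apply: near_eq_derive; apply: smfun_near => // y Uy; rewrite sderE.
by rewrite (e u v) (e v u); exact: schwarz oU Ux (smfun_Ck F 2).
Qed.

Definition scst (a : R) : A := smfun_of (fun k => Ck_cst k U a).

Lemma scstE a x : U x -> scst a x = a.
Proof. by move=> Ux; rewrite smfun_ofE. Qed.

Lemma sder_cst v a : sder v (scst a) = 0.
Proof.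
apply: smfun_eq => x Ux; rewrite sderE // smfun0E.
transitivity ('D_v (fun=> a : R) x); last exact: derive_cst.
by apply: near_eq_derive; apply: smfun_near => // y Uy; rewrite scstE.
Qed.

Lemma smfun_nonvanishing F : (forall x, U x -> F x != 0) -> exists G, F * G = 1.
Proof.
move=> F0; exists (smfun_of (fun k => CkV oU F0 (smfun_Ck F k))).
by apply: smfun_eq => x Ux; rewrite smfunME smfun_ofE // smfun1E // mulfV // F0.
Qed.

Lemma smfun_detE n (M : 'M[A]_n) x : U x ->
  (\det M) x = \det (map_mx (fun F : A => F x) M).
Proof.
move=> Ux; rewrite smfun_sumE; apply: eq_bigr => s _; rewrite smfunME; congr (_ * _).
  by case: (perm.odd_perm s); rewrite ?expr1 ?smfunNE ?expr0 smfun1E.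
rewrite (big_morph (fun F : A => F x) (fun F G => smfunME F G x) (smfun1E Ux)).
by apply: eq_bigr => i _; rewrite mxE.
Qed.

(** Cramer's rule: the determinant vanishes nowhere on [U], hence has a smooth inverse. *)
Lemma smfun_mx_invertible n (M : 'M[A]_n) :
  (forall x, U x -> map_mx (fun F : A => F x) M \in unitmx) ->
  exists N, M *m N = 1%:M.
Proof.
move=> Mu; have [G MG] : exists G, \det M * G = 1.
  apply: smfun_nonvanishing => x Ux; rewrite smfun_detE //.
  by have := Mu x Ux; rewrite unitmxE unitfE.
by exists (G *: \adj M); rewrite -scalemxAr mul_mx_adj scale_scalar_mx mulrC MG.
Qed.

End SmoothRing.

(** * Formal tensors of smooth functions compute the analytic tensors *)

Section Representation.
Context {R : realType} {V : normedModType R} {U : set V} {oU : open U}.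
Local Notation A := (smfun oU).

Lemma line_cvg (v x : V) : (fun h : R => h *: v + x) @ 0^' --> x.
Proof.
have c : {for 0, continuous (fun h : R => h *: v + x)}.
  by move=> ?; apply: cvgD; [apply: cvgZr_tmp|exact: cvg_cst].
by move/continuous_withinNx: c; rewrite scale0r add0r.
Qed.

Variables (n : nat) (e : 'I_n -> V) (prj : V -> 'rV[R]_n) (S : set V).
Hypothesis prj_line : forall h k z, prj (h *: e k + z) = h *: delta_mx 0 k + prj z.
Hypothesis S_line : forall h k z, S z -> S (h *: e k + z).
Implicit Types (F G : A) (f : 'rV[R]_n -> R) (i j k l : 'I_n).

(* Applied to the base, to the fibre and to the whole product at a fixed time. *)
Definition represents F f := forall z, U z -> S z -> F z = f (prj z).

Lemma representsD F1 F2 f1 f2 : represents F1 f1 -> represents F2 f2 ->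
  represents (F1 + F2) (fun x => f1 x + f2 x).
Proof. by move=> r1 r2 z Uz Sz; rewrite smfunDE r1 // r2. Qed.

Lemma representsB F1 F2 f1 f2 : represents F1 f1 -> represents F2 f2 ->
  represents (F1 - F2) (fun x => f1 x - f2 x).
Proof. by move=> r1 r2 z Uz Sz; rewrite smfunDE smfunNE r1 // r2. Qed.

Lemma representsM F1 F2 f1 f2 : represents F1 f1 -> represents F2 f2 ->
  represents (F1 * F2) (fun x => f1 x * f2 x).
Proof. by move=> r1 r2 z Uz Sz; rewrite smfunME r1 // r2. Qed.

Lemma represents_sum (I : Type) (r : seq I) (F : I -> A) (f : I -> 'rV[R]_n -> R) :
  (forall a, represents (F a) (f a)) ->
  represents (\sum_(i <- r) F i) (fun x => \sum_(i <- r) f i x).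
Proof. by move=> H z Uz Sz; rewrite smfun_sumE; apply: eq_bigr => i _; exact: H. Qed.

(** The line in direction [e k] stays in [S], and in [U] for small steps, so the two difference
    quotients coincide near 0. *)
Lemma represents_partial F f k : represents F f -> represents (sder (e k) F) (partial k f).
Proof.
move=> Ff z Uz Sz; rewrite sderE //; apply/esym/cvg_lim; first exact: norm_hausdorff.
have d : derivable F z (e k) by have [_ /(_ (e k)) [d _]] := smfun_Ck F 1; exact: d.
apply: cvg_trans d; apply: near_eq_cvg.
have nU : \forall h \near 0^', U (h *: e k + z).
  exact: (line_cvg (e k) (open_nbhs_nbhs (conj oU Uz))).
apply: filterS nU => h Uh /=.
by rewrite Ff ?prj_line ?Ff //; exact: S_line.
Qed.

Variables (G Gi : 'M[A]_n) (hf : A) (g : 'rV[R]_n -> 'M[R]_n).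
Hypothesis GG : G *m Gi = 1%:M.
Hypothesis hf2 : hf * 2 = 1.
Hypothesis Gg : forall i j, represents (G i j) (fun x => g x i j).
Local Notation D := (fun k => sder (e k)).
Local Notation chr := (fchr D G Gi hf).

Lemma half_val z : U z -> hf z = 2^-1.
Proof.
move=> Uz; have := congr1 (fun F : A => F z) hf2; rewrite smfunME smfun_natE // smfun1E //.
by move/(canRL (mulfK _)); rewrite mul1r; apply; rewrite pnatr_eq0.
Qed.

Lemma represents_inv i j : represents (Gi i j) (fun x => inv_metric g x i j).
Proof.
move=> z Uz Sz; rewrite /inv_metric.
pose ev (M : 'M[A]_n) : 'M[R]_n := map_mx (fun F : A => F z) M.
have gE : g (prj z) = ev G by apply/matrixP => a b; rewrite mxE Gg.
have e1 : ev G *m ev Gi = 1%:M.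
  apply/matrixP => a b; have /matrixP/(_ a b)/(congr1 (fun F : A => F z)) := GG.
  rewrite !mxE smfun_sumE smfun_natE // => <-.
  by apply: eq_bigr => k _; rewrite !mxE smfunME.
have [Gu _] := mulmx1_unit e1.
by rewrite gE -[invmx _]mulmx1 -e1 mulmxA mulVmx // mul1mx mxE.
Qed.

Lemma represents_chr k i j : represents (chr k i j) (christoffel g k i j).
Proof.
apply: representsM; first by move=> z Uz _; exact: half_val.
apply: represents_sum => l; apply: representsM; first exact: represents_inv.
by apply: representsB; [apply: representsD|]; apply: represents_partial.
Qed.

Lemma represents_riem i j k l :
  represents (friem D G Gi hf i j k l) (riemann g i j k l).
Proof.
apply: representsD.
  by apply: representsB; apply: represents_partial; exact: represents_chr.
apply: represents_sum => m.
by apply: representsB; apply: representsM; exact: represents_chr.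
Qed.

Lemma represents_ric j k : represents (fric D G Gi hf j k) (fun x => ricci_mx g x j k).
Proof.
move=> z Uz Sz; rewrite /fric /ricci_mx !mxE.
have H := represents_sum (index_enum 'I_n) (fun i => represents_riem i j k i).
exact: H Uz Sz.
Qed.

Variables (T : 'M[A]_n) (t : 'rV[R]_n -> 'M[R]_n).
Hypothesis Tt : forall i j, represents (T i j) (fun x => t x i j).

Lemma represents_cov k i j : represents (fcov D G Gi hf T k i j) (cov_deriv g t k i j).
Proof.
apply: representsB; first exact: represents_partial.
apply: represents_sum => m.
by apply: representsD; apply: representsM => //; exact: represents_chr.
Qed.

Lemma represents_cov2 k l i j :
  represents (fcov2 D G Gi hf T k l i j) (cov_deriv2 g t k l i j).
Proof.
apply: representsB; first by apply: represents_partial; exact: represents_cov.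
apply: represents_sum => m; apply: representsD; first apply: representsD.
all: by apply: representsM; [exact: represents_chr | exact: represents_cov].
Qed.

Lemma represents_laplacian i j :
  represents (flaplacian D G Gi hf T i j) (fun x => laplacian_mx g t x i j).
Proof.
move=> z Uz Sz; rewrite /flaplacian /laplacian_mx !mxE.
have H k l := representsM (represents_inv k l) (represents_cov2 k l i j).
have H' k := represents_sum (index_enum 'I_n) (H k).
exact: (represents_sum (index_enum 'I_n) H') Uz Sz.
Qed.

End Representation.

(** * Time derivatives *)

(** Every point of a nondegenerate interval is a limit of other points of it, so derivatives within
    [J] are unique. *)
Lemma within_interval_proper (R : realType) (J : set R) (t : R) :
  is_interval J -> (exists s r, [/\ J s, J r & s < r]) -> J t ->
  ProperFilter (within J t^').
Proof.
move=> iJ [s [r [Js Jr sr]]] Jt.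
apply: Build_ProperFilter_ex => P /nbhs_ballP [e /= e0 eP].
suff [u [Ju ut ue]] : exists u, [/\ J u, u != t & `|t - u| < e].
  by exists u; apply: eP => //; rewrite -ball_normE.
have e2 : e / 2 < e by rewrite ltr_pdivrMr // ltr_pMr // ltr1n.
have e20 : 0 < e / 2 by rewrite divr_gt0.
have [tr|rt] := ltP t r.
  exists (Num.min r (t + e / 2)); have m1 : t < Num.min r (t + e / 2).
    by rewrite lt_min tr ltrDl.
  split; last 1 first.
  - rewrite ltr0_norm ?subr_lt0 // opprB ltrBlDr (@le_lt_trans _ _ (t + e / 2)) //.
      by rewrite ge_min lexx orbT.
    by rewrite addrC ltrD2r.
  - by apply: (iJ t r) => //; rewrite ltW //= ge_min lexx.
  - by rewrite gt_eqF.
have st : s < t by exact: lt_le_trans rt.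
exists (Num.max s (t - e / 2)); have m1 : Num.max s (t - e / 2) < t.
  by rewrite gt_max st /= ltrBlDr ltrDl.
split; last 1 first.
- rewrite gtr0_norm ?subr_gt0 // ltrBlDr -ltrBlDl (@lt_le_trans _ _ (t - e / 2)) //.
    by rewrite ltrD2l ltrN2.
  by rewrite le_max lexx orbT.
- by apply: (iJ s t) => //; rewrite le_max lexx /= ltW.
- by rewrite lt_eqF.
Qed.

Section TimeDerivative.
Context {R : realType} {n : nat} {U : set ('rV[R]_n * R)%type} {oU : open U}.
Local Notation A := (smfun oU).
Implicit Types (F G : A) (z : ('rV[R]_n * R)%type).

Definition time_der : A -> A := sder ((0, 1) : ('rV[R]_n * R)%type).
Definition space_der (k : 'I_n) : A -> A := sder ((delta_mx 0 k, 0) : ('rV[R]_n * R)%type).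

Lemma time_der_within (J : set R) F (f : R -> R) (x : 'rV[R]_n) t : U (x, t) -> J t ->
  (forall s, J s -> U (x, s) -> F (x, s) = f s) ->
  has_derivative_within J f t (time_der F (x, t)).
Proof.
move=> Ut Jt Ff; rewrite /has_derivative_within.
have d : derivable F (x, t) ((0, 1) : ('rV[R]_n * R)%type).
  by have [_ /(_ (0, 1)) [d _]] := smfun_Ck F 1; exact: d.
have dc : (fun h : R => h^-1 *: (F (h *: (0, 1) + (x, t)) - F (x, t))) @ 0^' --> time_der F (x, t).
  by rewrite /time_der sderE //; exact: d.
have shift : (fun s : R => s - t) @ (within J t^') --> 0^'.
  move=> P /nbhs_ballP [e /= e0 eP]; apply/nbhs_ballP; exists e => //= s ts st Js.
  apply: eP; last by rewrite subr_eq0.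
  by move: ts; rewrite -!ball_normE /ball_ /= sub0r normrN distrC.
have := cvg_comp _ _ shift dc; apply: cvg_trans; apply: near_eq_cvg.
have lineE s : (s - t) *: ((0, 1) : ('rV[R]_n * R)%type) + (x, t) = (x, s).
  by congr pair; rewrite /= ?scaler0 ?add0r // /GRing.scale /= mulr1 subrK.
have nU : \forall s \near t, U (x, s).
  have c : (fun s : R => (x, s)) @ t --> (x, t).
    exact: (cvg_pair (cvg_cst x) cvg_id).
  exact: c (open_nbhs_nbhs (conj oU Ut)).
have nU' : \forall s \near t^', U (x, s) by exact: nbhs_dnbhs.
rewrite near_withinE; apply: filter_app nU'; apply: nearW => s _ Us Js /=.
by rewrite lineE !Ff // /GRing.scale /= mulrC.
Qed.

Variable t : R.

(* The flow equation holds at times of [J] only, and [J] need not be open: it *)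
(* is substituted through this relation, which survives space derivatives.    *)
Definition slice_eq F G := forall z, U z -> z.2 = t -> F z = G z.

Lemma slice_eqD F F' G G' : slice_eq F F' -> slice_eq G G' -> slice_eq (F + G) (F' + G').
Proof. by move=> e1 e2 z Uz zt; rewrite !smfunDE e1 // e2. Qed.

Lemma slice_eqN F F' : slice_eq F F' -> slice_eq (- F) (- F').
Proof. by move=> e1 z Uz zt; rewrite !smfunNE e1. Qed.

Lemma slice_eqM F F' G G' : slice_eq F F' -> slice_eq G G' -> slice_eq (F * G) (F' * G').
Proof. by move=> e1 e2 z Uz zt; rewrite !smfunME e1 // e2. Qed.

Lemma slice_eq_sum (I : Type) (r : seq I) (F F' : I -> A) :
  (forall i, slice_eq (F i) (F' i)) -> slice_eq (\sum_(i <- r) F i) (\sum_(i <- r) F' i).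
Proof. by move=> e z Uz zt; rewrite !smfun_sumE; apply: eq_bigr => i _; exact: e. Qed.

Lemma slice_eq_sum2 (I J : finType) (F F' : I -> J -> A) :
  (forall k l, slice_eq (F k l) (F' k l)) ->
  slice_eq (\sum_k \sum_l F k l) (\sum_k \sum_l F' k l).
Proof. by move=> e; do 2!(apply: slice_eq_sum => ?); exact: e. Qed.

(** Space directions stay in the time slice: [represents_partial] is applied to the difference,
    which represents 0 there. *)
Lemma slice_eq_space_der k F G : slice_eq F G -> slice_eq (space_der k F) (space_der k G).
Proof.
move=> FG z Uz zt; apply/eqP; rewrite -subr_eq0 -smfunNE -smfunDE.
rewrite -(derB (sder_derivation _)).
have rep : represents fst [set z | z.2 = t] (F - G) (fun=> 0).
  by move=> w Uw wt; rewrite smfunDE smfunNE FG // subrr.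
have := @represents_partial _ _ _ oU _ (fun k => (delta_mx 0 k, 0)) fst
  [set z | z.2 = t] _ _ (F - G) (fun=> 0) k rep z Uz zt.
rewrite /space_der => ->.
- by rewrite /partial (derive_cst 0).
- by move=> h l w; rewrite /=.
- by move=> h l w /= ->; rewrite scaler0 add0r.
Qed.

End TimeDerivative.

(** * The evolution equation in the ring of smooth functions *)

Section WarpedEvolution.
Context {R : realType} {m1 m2 : nat} {U : set ('rV[R]_(m1 + m2) * R)%type} {oU : open U}.
Local Notation A := (smfun oU).
Variables (g gi : 'M[A]_m1) (gam gami : 'M[A]_m2) (lam lami h : A).
Local Notation L := (@lshift m1 m2).
Local Notation Rt := (@rshift m1 m2).
Local Notation D := (@space_der _ _ _ oU).
Local Notation d1 := (fun i => D (L i)).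
Local Notation d2 := (fun a => D (Rt a)).
Hypothesis wd : warped_data D g gi gam gami lam lami h.
Local Notation W := (wmet g gam lam).
Local Notation Wi := (wmeti gi gami lami).
Local Notation ric := (fric D W Wi h).
Local Notation ric1 := (fric d1 g gi h).
Local Notation ric2 := (fric d2 gam gami h).
Variables (c t : R).
Hypothesis einst : forall a b, ric2 a b = scst c * gam a b.
Hypothesis gam_static : forall a b, time_der (gam a b) = 0.
Hypothesis m2_gt0 : (0 < m2)%N.
Hypothesis gam_pos : forall a z, U z -> 0 < gam a a z.
Hypothesis flow : forall a b, slice_eq t (time_der (W a b)) (- 2 * ric a b).

Let cD s : D s (scst c) = 0. Proof. exact: sder_cst. Qed.
Let dtD : derivation (@time_der _ _ _ oU). Proof. exact: sder_derivation. Qed.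
Let dtC s f : time_der (D s f) = D s (time_der f). Proof. exact: sder_comm. Qed.
Local Notation mu := (ric_mu D g gi lam h (scst c)).
Local Notation nu := (ric_nu D g gi lam lami h (scst c)).
Local Notation P := (ric_base D g gi lam lami h).

Lemma g_flow i j : slice_eq t (time_der (g i j)) ((- 2 *: P) i j).
Proof.
rewrite -[g i j](WLL g gam lam); move=> z Uz zt; rewrite flow //.
by rewrite (ric_baseE wd) [in RHS]mxE.
Qed.

(** A diagonal fibre component of the flow, which exists as m2 > 0, reads 2 lam lam' gam_aa = -2
    lam^2 nu gam_aa; the factors 2, lam and gam_aa are nonzero and cancel. *)
Lemma lam_flow : slice_eq t (time_der lam) (- (lam * nu)).
Proof.
move=> z Uz zt; pose a := Ordinal m2_gt0.
have := flow (Rt a) (Rt a) Uz zt.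
rewrite WRR (derM dtD) gam_static mulr0 addr0 expr2 (derM dtD).
rewrite (ricRR_mu wd einst) (ric_mu_nu wd).
rewrite [in LHS]smfunME smfunDE !smfunNE !smfunME smfunNE smfun_natE // => e.
have gp := gam_pos a Uz.
have l0 : lam z != 0.
  apply/eqP => l0; have := congr1 (fun F : A => F z) (wd_lam wd).
  by rewrite smfunME l0 mul0r smfun1E // => /esym/eqP; rewrite oner_eq0.
apply: (mulIf (lt0r_neq0 gp)); apply: (mulfI l0).
have two : (2 : R) != 0 by rewrite pnatr_eq0.
apply: (mulfI two).
transitivity ((time_der lam z * lam z + lam z * time_der lam z) * gam a a z); first ring.
rewrite e; ring.
Qed.

Lemma slice_eq_flap_var (T T' : 'M[A]_m1) (v v' : A) :
  (forall i j, slice_eq t (T i j) (T' i j)) -> slice_eq t v v' ->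
  slice_eq t (flap_var d1 g gi h T lam v) (flap_var d1 g gi h T' lam v').
Proof.
move=> eT ev; apply: slice_eqD; first apply: slice_eqD.
- apply: slice_eq_sum2 => k l; apply: slice_eqM => //; apply: slice_eqD.
    by do 2!apply: slice_eq_space_der.
  apply: slice_eqN; apply: slice_eq_sum => m; apply: slice_eqM => //.
  exact: slice_eq_space_der.
- apply: slice_eqN; apply: slice_eq_sum2 => k l; apply: slice_eqM => //.
  by apply: slice_eq_sum2 => p q; apply: slice_eqM.
apply: slice_eqN; apply: slice_eq_sum => l; apply: slice_eqM => //.
apply: slice_eqD.
  apply: slice_eq_sum2 => k m; apply: slice_eqM => //; apply: slice_eqD.
    by apply: slice_eq_space_der.
  apply: slice_eqN; apply: slice_eq_sum => p.
  by apply: slice_eqD; apply: slice_eqM.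
apply: slice_eqN; apply: slice_eqM => //; apply: slice_eq_space_der.
by apply: slice_eq_sum2 => k m; apply: slice_eqM.
Qed.

Lemma slice_eq_mu_var (T T' : 'M[A]_m1) (v v' : A) :
  (forall i j, slice_eq t (T i j) (T' i j)) -> slice_eq t v v' ->
  slice_eq t (mu_var D g gi lam h T v) (mu_var D g gi lam h T' v').
Proof.
move=> eT ev; apply: slice_eqN; apply: slice_eqD; first apply: slice_eqD.
- exact: slice_eqM.
- by apply: slice_eqM => //; exact: slice_eq_flap_var.
apply: slice_eqM => //; apply: slice_eqD; first apply: slice_eqM => //.
  apply: slice_eq_sum2 => k l; apply: slice_eqM => //.
  exact: slice_eq_space_der.
apply: slice_eqN; apply: slice_eq_sum2 => k l; apply: slice_eqM => //.
by apply: slice_eq_sum2 => p q; apply: slice_eqM.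
Qed.

Lemma ricci_evolution_at a b z : U z -> z.2 = t ->
  time_der (ric (Rt a) (Rt b)) z = flaplacian D W Wi h ric (Rt a) (Rt b) z
  - 2 / m2%:R * (\sum_k \sum_p Wi (L k) (L p) z
        * (ric (L k) (L p) z - ric1 k p z)) * ric (Rt a) (Rt b) z
  + 2 / m2%:R * (\sum_k \sum_l \sum_p \sum_q Wi (L k) (L l) z * Wi (L p) (L q) z
        * (ric (L k) (L p) z - ric1 k p z) * ric (L l) (L q) z) * W (Rt a) (Rt b) z.
Proof.
move=> Uz zt.
rewrite (laplacian_ric wd cD einst) (ricRR_mu wd einst) (derM dtD) gam_static mulr0 addr0.
rewrite (dt_mu wd dtD dtC (sder_cst _ _)) smfunME.
(* Only here is the flow used: [mu_var] takes only space derivatives of the velocities, so they may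
   be replaced on the slice. *)
have -> : mu_var D g gi lam h (map_mx (@time_der _ _ _ oU) g) (time_der lam) z =
    mu_var D g gi lam h (- 2 *: P) (- (lam * nu)) z.
  apply: slice_eq_mu_var => //; last exact: lam_flow.
  by move=> i j; rewrite mxE; exact: g_flow.
rewrite (mu_var_flow wd einst).
have m20 : m2%:R != 0 :> R by rewrite pnatr_eq0 -lt0n.
have ll : lam z * lami z = 1 by rewrite -smfunME (wd_lam wd) smfun1E.
have DE k p : ric (L k) (L p) z - ric1 k p z =
    - (m2%:R * lami z * fhess d1 g gi h lam k p z).
  by rewrite (ricLL wd) smfunDE smfunNE !smfunME smfun_natE //; ring.
have -> : \sum_k \sum_p Wi (L k) (L p) z * (ric (L k) (L p) z - ric1 k p z) =
    - (m2%:R * lami z * flap d1 g gi h lam z).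
  rewrite smfun_sumE mulr_sumr -sumrN; apply: eq_bigr => k _.
  rewrite smfun_sumE mulr_sumr -sumrN; apply: eq_bigr => p _.
  by rewrite DE WiLL smfunME; ring.
have -> : \sum_k \sum_l \sum_p \sum_q Wi (L k) (L l) z * Wi (L p) (L q) z
    * (ric (L k) (L p) z - ric1 k p z) * ric (L l) (L q) z =
    - (m2%:R * lami z * (\sum_k \sum_l (\sum_p \sum_q gi k p * gi l q * P p q)
      * fhess d1 g gi h lam k l) z).
  rewrite smfun_sumE mulr_sumr -sumrN; apply: eq_bigr => k _.
  rewrite exchange_big smfun_sumE mulr_sumr -sumrN; apply: eq_bigr => p _.
  transitivity (- (m2%:R * lami z * fhess d1 g gi h lam k p z)
      * (\sum_l \sum_q gi k l * gi p q * P l q) z); last by rewrite smfunME; ring.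
  rewrite smfun_sumE mulr_sumr; apply: eq_bigr => l _.
  rewrite smfun_sumE mulr_sumr; apply: eq_bigr => q _.
  by rewrite DE (ric_baseE wd) !WiLL !smfunME; ring.
move: (\sum_k _ : A) => S; rewrite WRR (ric_mu_nu wd).
move: (flap d1 g gi h lam) nu => X v.
move: (tensor_on_grad _ _ _ _) (fdot d1 gi lam lam) (fdot d1 gi lam v) => q dl dv.
move: (lam ^+ 2 * flap d1 g gi h v + _ + _) => B.
rewrite [in LHS]smfunDE [in LHS]smfunDE smfunNE !smfunME smfun_natE //.
move: (B z) (S z) (X z) (v z) (gam a b z) => b0 s0 x0 v0 g0.
move: (lam z) (lami z) ll => l0 l1 ll.
transitivity (b0 * g0 + 2 * l0 * (l0 * l1) * v0 * x0 * g0 - 2 * l0 * (l0 * l1) * s0 * g0).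
  by rewrite ll; ring.
by field.
Qed.

End WarpedEvolution.

Lemma posdef_unitmx (R : realFieldType) n (M : 'M[R]_n) :
  (forall v : 'rV_n, v != 0 -> 0 < (v *m M *m v^T) 0 0) -> M \in unitmx.
Proof.
move=> pos; rewrite -row_free_unit -kermx_eq0.
apply/negPn/negP => /rowV0Pn [v /sub_kermxP vM v0].
by have := pos v v0; rewrite vM mul0mx mxE ltxx.
Qed.

Lemma posdef_diag (R : realFieldType) n (M : 'M[R]_n) a :
  (forall v : 'rV_n, v != 0 -> 0 < (v *m M *m v^T) 0 0) -> 0 < M a a.
Proof.
move=> pos; have := pos (delta_mx 0 a); rewrite -rowE trmx_delta -colE !mxE; apply.
by apply/eqP => /matrixP/(_ 0 a)/eqP; rewrite !mxE !eqxx oner_eq0.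
Qed.

Section SmoothRingMore.
Context {R : realType} {V : normedModType R} {U : set V} {oU : open U}.

Lemma open_nonvanishing (F : smfun oU) : open (U `&` [set z | F z != 0]).
Proof.
rewrite openE => z [Uz Fz]; apply: filterI; first exact: open_nbhs_nbhs.
have [c _] := smfun_Ck F 0; exact: (cvgr_neq0 _ (c z Uz) Fz).
Qed.

Lemma sder_const_along v (F : smfun oU) :
  (forall h z, U z -> U (h *: v + z) -> F (h *: v + z) = F z) -> sder v F = 0.
Proof.
move=> Fv; apply: smfun_eq => z Uz; rewrite sderE // smfun0E.
apply/cvg_lim; first exact: norm_hausdorff.
apply: (@cvg_trans _ ((fun=> 0 : R) @ (0 : R)^')); last exact: cvg_cst.
apply: near_eq_cvg.
have nU : \forall h \near 0^', U (h *: v + z).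
  exact: (line_cvg v (open_nbhs_nbhs (conj oU Uz))).
by apply: filterS nU => h Uh /=; rewrite Fv // subrr scaler0.
Qed.

End SmoothRingMore.

(** * Projections of product coordinates and time to the base and to the fibre *)

Section CoordinateMaps.
Context {R : realType} {m1 m2 : nat}.
Local Notation V := ('rV[R]_(m1 + m2) * R)%type.

Definition base_point (z : V) : 'rV[R]_m1 * R := (lsubmx z.1, z.2).
Definition fiber_point (z : V) : 'rV[R]_m2 := rsubmx z.1.

Lemma base_point_linear : linear base_point.
Proof. by move=> a u v; congr pair; rewrite /= linearP. Qed.

Lemma fiber_point_linear : linear fiber_point.
Proof. by move=> a u v; rewrite /fiber_point /= linearP. Qed.

Lemma base_point_continuous : continuous base_point.
Proof.
move=> z.
exact: (cvg_pair (cvg_comp_at (x := z) cvg_fst (@continuous_lsubmx _ _ _ _ z.1)) cvg_snd).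
Qed.

Lemma fiber_point_continuous : continuous fiber_point.
Proof. by move=> z; exact: (cvg_comp_at (x := z) cvg_fst (@continuous_rsubmx _ _ _ _ z.1)). Qed.

Lemma lsubmx_line h k (w : 'rV[R]_(m1 + m2)) :
  lsubmx (h *: delta_mx 0 (lshift m2 k) + w) = h *: delta_mx 0 k + lsubmx w.
Proof. by apply/matrixP => i j; rewrite !mxE (inj_eq (@lshift_inj _ _)). Qed.

Lemma rsubmx_line h k (w : 'rV[R]_(m1 + m2)) :
  rsubmx (h *: delta_mx 0 (rshift m1 k) + w) = h *: delta_mx 0 k + rsubmx w.
Proof. by apply/matrixP => i j; rewrite !mxE (inj_eq (@rshift_inj _ _)). Qed.

Lemma lsubmx_liner h k (w : 'rV[R]_(m1 + m2)) :
  lsubmx (h *: delta_mx 0 (rshift m1 k) + w) = lsubmx w.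
Proof. by apply/matrixP => i j; rewrite !mxE eq_lrshift andbF mulr0 add0r. Qed.

Lemma rsubmx_linel h k (w : 'rV[R]_(m1 + m2)) :
  rsubmx (h *: delta_mx 0 (lshift m2 k) + w) = rsubmx w.
Proof. by apply/matrixP => i j; rewrite !mxE eq_rlshift andbF mulr0 add0r. Qed.

End CoordinateMaps.

Theorem theorem5p6 (R : realType) (m1 m2 : nat)
    (M1 : manifold R m1) (M2 : manifold R m2)
    (J : set R) (g1 : R -> tensor2 M1) (lambda : M1 -> R -> R)
    (g2 : tensor2 M2) (c : R)
    (m2_ge2 : (2 <= m2)%N)
    (J_interval : is_interval J)
    (J_nondegenerate : exists s t : R, [/\ J s, J t & s < t])
    (g1_metric : forall t, J t -> riemannian_metric (g1 t))
    (g1_smooth : smooth_tensor_family J g1)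
    (lambda_pos : forall p t, J t -> 0 < lambda p t)
    (lambda_smooth : smooth_function_family J lambda)
    (g2_metric : riemannian_metric g2)
    (g2_einstein : einstein g2 c)
    (gbar_flow : ricci_flow J
      (fun t => warped_metric (g1 t) (fun p => lambda p t) g2)) :
  forall (c1 : chart M1) (c2 : chart M2) (x : 'rV[R]_m1) (y : 'rV[R]_m2)
    (t : R) (alpha beta : 'I_m2),
    chart_img c1 x -> chart_img c2 y -> J t ->
  let gbar : R -> tensor2 (prod_manifold M1 M2) :=
    fun s => warped_metric (g1 s) (fun p => lambda p s) g2 in
  let at_xy (T : tensor2 (prod_manifold M1 M2)) : 'M[R]_(m1 + m2) :=
    T (c1, c2) (row_mx x y) in
  let latin (k : 'I_m1) : 'I_(m1 + m2) := lshift m2 k in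
  let greek (a : 'I_m2) : 'I_(m1 + m2) := rshift m1 a in
  let G : 'M[R]_(m1 + m2) := at_xy (gbar t) in
  let Ginv : 'M[R]_(m1 + m2) := invmx G in
  let Ric : 'M[R]_(m1 + m2) := at_xy (ricci (gbar t)) in
  let Ric1 : 'M[R]_m1 := ricci (g1 t) c1 x in
  let D (k p : 'I_m1) : R := Ric (latin k) (latin p) - Ric1 k p in
  has_derivative_within J
    (fun s => at_xy (ricci (gbar s)) (greek alpha) (greek beta)) t
    (at_xy (laplacian (gbar t) (ricci (gbar t))) (greek alpha) (greek beta)
     - 2 / m2%:R * (\sum_k \sum_p Ginv (latin k) (latin p) * D k p)
       * Ric (greek alpha) (greek beta)
     + 2 / m2%:R
       * (\sum_k \sum_l \sum_p \sum_q
            Ginv (latin k) (latin l) * Ginv (latin p) (latin q)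
            * D k p * Ric (latin l) (latin q))
       * G (greek alpha) (greek beta)).
Proof.
move=> c1 c2 x y t alpha beta cx cy Jt.
have [U1 [F1 [oU1 U1t kF1 eF1]]] := g1_smooth c1 (x, t) (conj cx Jt).
have [U3 [F3 [oU3 U3t kF3 eF3]]] := lambda_smooth c1 (x, t) (conj cx Jt).
have [_ g2_smooth g2_sym g2_pos] := g2_metric.
have [U2 [F2 [oU2 U2y kF2 eF2]]] := g2_smooth c2 y cy.
pose V := ('rV[R]_(m1 + m2) * R)%type.
pose bp : V -> _ := @base_point R m1 m2; pose fp : V -> _ := @fiber_point R m1 m2.
have cbp : continuous bp by exact: base_point_continuous.
have cfp : continuous fp by exact: fiber_point_continuous.
(* Where all three smooth extensions live and the coordinates stay in the chart images. *)
pose U0 : set V := (bp @^-1` U1 `&` bp @^-1` U3) `&` (fp @^-1` U2 `&`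
  ((fun z => (bp z).1) @^-1` chart_img c1 `&` fp @^-1` chart_img c2)).
have oU0 : open U0.
  apply: openI; first by apply: openI; apply: open_comp => // z _; exact: cbp.
  apply: openI; first by apply: open_comp => // z _; exact: cfp.
  apply: openI; apply: open_comp; try exact: open_chart_img.
    move=> z _; exact: (cvg_comp_at (cbp z) cvg_fst).
  by move=> z _; exact: cfp.
(* The extension of [g1] is known to be symmetric at times of [J] only, so it is symmetrised; this
   changes nothing at those times. *)
have kg i j k : Ck k U0 (fun z => 2^-1 * (F1 (bp z) i j + F1 (bp z) j i)).
  have K a b : Ck k U0 (fun z => F1 (bp z) a b).
    apply: (@Ck_subset _ _ _ k (bp @^-1` U1)); first by move=> z [[]].
    have := Ck_entry a b oU1 (kF1 k).
    exact: Ck_precomp cbp (@base_point_linear R m1 m2).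
  by apply: CkM => //; [exact: Ck_cst|apply: CkD].
have kl k : Ck k U0 (fun z => F3 (bp z)).
  apply: (@Ck_subset _ _ _ k (bp @^-1` U3)); first by move=> z [[]].
  exact: Ck_precomp cbp (@base_point_linear R m1 m2) (kF3 k).
have kgam a b k : Ck k U0 (fun z => F2 (fp z) a b).
  apply: (@Ck_subset _ _ _ k (fp @^-1` U2)); first by move=> z [_ []].
  have := Ck_entry a b oU2 (kF2 k).
  exact: Ck_precomp cfp (@fiber_point_linear R m1 m2).
(* Outside [J] the extensions of the metric and of lambda need not be invertible; [U] is cut down to
   where they are. *)
pose d : smfun oU0 := \det (\matrix_(i, j) smfun_of (kg i j)) * smfun_of kl.
pose U := U0 `&` [set z | d z != 0].
have oU : open U by exact: open_nonvanishing.
have UU0 : U `<=` U0 by move=> z [].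
pose g : 'M[smfun oU]_m1 := \matrix_(i, j) smfun_of (fun k => Ck_subset UU0 (kg i j k)).
pose lam : smfun oU := smfun_of (fun k => Ck_subset UU0 (kl k)).
pose gam : 'M[smfun oU]_m2 :=
  \matrix_(a, b) smfun_of (fun k => Ck_subset UU0 (kgam a b k)).
have inU z : U z -> [/\ U1 (bp z), U3 (bp z), U2 (fp z), chart_img c1 (lsubmx z.1) &
    chart_img c2 (fp z)] by move=> [[[? ?] [? [? ?]]] _].
have gE0 i j z : U z -> g i j z = 2^-1 * (F1 (bp z) i j + F1 (bp z) j i).
  by move=> Uz; rewrite mxE smfun_ofE.
have lamE0 z : U z -> lam z = F3 (bp z) by move=> Uz; rewrite smfun_ofE.
have gamE a b z : U z -> gam a b z = g2 c2 (fp z) a b.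
  by move=> Uz; have [_ _ ? _ ?] := inU z Uz; rewrite mxE smfun_ofE // eF2.
have avg (M : 'M[R]_m1) i j : M^T = M -> 2^-1 * (M i j + M j i) = M i j.
  by move=> /matrixP/(_ i j); rewrite mxE => ->; field.
have gE i j z : U z -> J z.2 -> g i j z = g1 z.2 c1 (lsubmx z.1) i j.
  move=> Uz Jz; have [? _ _ ? _] := inU z Uz; rewrite gE0 // eF1 //= avg //.
  by have [_ _ sym _] := g1_metric _ Jz; exact: sym.
have lamE z : U z -> J z.2 -> lam z = lambda (from_coord c1 (lsubmx z.1)) z.2.
  by move=> Uz Jz; have [_ ? _ ? _] := inU z Uz; rewrite lamE0 // eF3.
(* At the given point positivity of [g1 t] and of lambda ensures that [d] does not vanish. *)
have Uz0 : U (row_mx x y, t).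
  have e1 : bp (row_mx x y, t) = (x, t) by rewrite /bp /base_point row_mxKl.
  have e2 : fp (row_mx x y, t) = y by rewrite /fp /fiber_point row_mxKr.
  have U0z : U0 (row_mx x y, t).
    by split; [split|split; [|split]]; rewrite /preimage /mkset ?e1 ?e2.
  split=> //; rewrite /mkset /d smfunME mulf_neq0 //.
    rewrite smfun_detE //.
    have -> : map_mx (fun F : smfun oU0 => F (row_mx x y, t))
        (\matrix_(i, j) smfun_of (kg i j)) = g1 t c1 x.
      have [_ _ sym _] := g1_metric _ Jt.
      apply/matrixP => i j; rewrite !mxE smfun_ofE // e1 eF1 //= avg //; exact: sym.
    rewrite -unitfE -unitmxE; apply: posdef_unitmx.
    by have [_ _ _ pos] := g1_metric _ Jt; exact: pos.
  by rewrite smfun_ofE // e1 eF3 //= gt_eqF // lambda_pos.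
have [gi ggi] : exists gi, g *m gi = 1%:M.
  apply: smfun_mx_invertible => z Uz; rewrite unitmxE unitfE.
  have : d z != 0 by case: Uz.
  rewrite /d smfunME mulf_eq0 negb_or smfun_detE => [/andP[+ _]|]; last exact: (UU0 z).
  congr (\det _ != 0); apply/matrixP => i j; rewrite !mxE !smfun_ofE //; exact: (UU0 z).
have [lami laml] : exists lami, lam * lami = 1.
  apply: smfun_nonvanishing => z Uz; have : d z != 0 by case: Uz.
  rewrite /d smfunME mulf_eq0 negb_or => /andP[_].
  by rewrite lamE0 // smfun_ofE //; exact: (UU0 z).
have gam_pd z : U z -> forall v : 'rV_m2, v != 0 -> 0 < (v *m g2 c2 (fp z) *m v^T) 0 0.
  by move=> Uz; apply: g2_pos; have [] := inU z Uz.
have [gami gamg] : exists gami, gam *m gami = 1%:M.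
  apply: smfun_mx_invertible => z Uz.
  have -> : map_mx (fun F : smfun oU => F z) gam = g2 c2 (fp z).
    by apply/matrixP => a b; rewrite mxE gamE.
  exact: posdef_unitmx (gam_pd z Uz).
pose hf : smfun oU := scst 2^-1.
have hf2 : hf * 2 = 1.
  apply: smfun_eq => z Uz; rewrite smfunME scstE // smfun_natE // smfun1E //.
  by rewrite mulVf // pnatr_eq0.
have line_base h (w : V) k : bp (h *: ((delta_mx 0 (rshift m1 k), 0) : V) + w) = bp w.
  by congr pair; rewrite /= ?lsubmx_liner // scaler0 add0r.
have line_fib h (w : V) k : fp (h *: ((delta_mx 0 (lshift m2 k), 0) : V) + w) = fp w.
  by rewrite /fp /fiber_point /= rsubmx_linel.
have wd : warped_data (@space_der _ _ _ oU) g gi gam gami lam lami hf.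
  split=> //.
  - by move=> s; exact: sder_derivation.
  - by move=> s r f; exact: sder_comm.
  - split=> //.
    + by move=> i; exact: sder_derivation.
    + by move=> i j f; exact: sder_comm.
    + apply/matrixP => i j; rewrite mxE; apply: smfun_eq => z Uz.
      by rewrite !gE0 // addrC.
  - split=> //.
    + by move=> i; exact: sder_derivation.
    + by move=> i j f; exact: sder_comm.
    + apply/matrixP => a b; rewrite mxE; apply: smfun_eq => z Uz.
      have [_ _ _ _ cz] := inU z Uz.
      by have /matrixP/(_ a b) := g2_sym c2 _ cz; rewrite mxE !gamE.
  - move=> a; apply: sder_const_along => h z Uz Uhz.
    by rewrite !lamE0 // line_base.
  - move=> a i j; apply: sder_const_along => h z Uz Uhz.
    by rewrite !gE0 // line_base.
  - move=> i a b; apply: sder_const_along => h z Uz Uhz.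
    by rewrite !gamE // line_fib.
have gam_static a b : time_der (gam a b) = 0.
  apply: sder_const_along => h z Uz Uhz; rewrite !gamE //.
  by rewrite /fp /fiber_point /= scaler0 add0r.
pose S s : set V := [set z | z.2 = s].
have S_line s h k z : S s z -> S s (h *: ((delta_mx 0 k, 0) : V) + z).
  by rewrite /S /= => ->; rewrite scaler0 add0r.
have fm := wmet_formal wd.
pose gb s := warped_metric (g1 s) (lambda^~ s) g2 (c1, c2).
have repW s : J s -> forall a b,
    represents fst (S s) (wmet g gam lam a b) (fun w => gb s w a b).
  move=> Js a b z Uz Sz; have Jz : J z.2 by rewrite Sz.
  rewrite /gb /warped_metric.
  case: (split_ordP a) => i ->; case: (split_ordP b) => j ->.
  - by rewrite WLL block_mxEul gE // Sz.
  - by rewrite WLR block_mxEur mxE smfun0E.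
  - by rewrite WRL block_mxEdl mxE smfun0E.
  - by rewrite WRR block_mxEdr [in RHS]mxE smfunME gamE // expr2 smfunME lamE // Sz expr2.
have fst_line h k (z : V) : (h *: ((delta_mx 0 k, 0) : V) + z).1 = h *: delta_mx 0 k + z.1.
  by [].
have repRic s (Js : J s) a b := represents_ric fst_line (S_line s) (fm_inv fm)
  (fm_half fm) (repW s Js) a b.
have ricE s z a b : J s -> U z -> z.2 = s ->
    fric (@space_der _ _ _ oU) (wmet g gam lam) (wmeti gi gami lami) hf a b z
    = ricci_mx (gb s) z.1 a b.
  by move=> Js Uz zs; exact: repRic s Js a b z Uz zs.
have einst a b : fric (fun e => @space_der _ _ _ oU (rshift m1 e)) gam gami hf a b
    = scst c * gam a b.
  apply: smfun_eq => z Uz; have [_ _ _ _ cz] := inU z Uz.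
  have rep_gam e f : represents fp setT (gam e f) (fun w => g2 c2 w e f).
    by move=> w Uw _; exact: gamE.
  have fp_line h k (w : V) :
      fp (h *: ((delta_mx 0 (rshift m1 k), 0) : V) + w) = h *: delta_mx 0 k + fp w.
    by rewrite /fp /fiber_point /= rsubmx_line.
  have fm2 := wd_fm2 wd.
  have -> := represents_ric (S := setT) fp_line (fun _ _ _ _ => I) (fm_inv fm2)
    (fm_half fm2) rep_gam a b Uz I.
  by rewrite -[LHS]/(ricci g2 c2 (fp z) a b) g2_einstein // mxE smfunME scstE // gamE.
have PF := within_interval_proper J_interval J_nondegenerate Jt.
(* The hypothesis and the smooth extension each give a derivative of the same function within [J];
   the two agree by uniqueness, for which [PF] is needed. *)
have flow a b : slice_eq t (time_der (wmet g gam lam a b))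
    (- 2 * fric (@space_der _ _ _ oU) (wmet g gam lam) (wmeti gi gami lami) hf a b).
  move=> [w s] Uz st; have {}st : s = t by []; rewrite {}st in Uz *.
  have cw : chart_img (M := prod_manifold M1 M2) (c1, c2) w.
    rewrite /chart_img prod_chart_imgE /=.
    by have [_ _ _ ? ?] := inU _ Uz.
  have f1 := gbar_flow (c1, c2) w t cw Jt a b.
  have f2 : has_derivative_within J (fun s => gb s w a b) t
      (time_der (wmet g gam lam a b) (w, t)).
    by apply: time_der_within => // r Jr Ur; exact: repW r Jr a b (w, r) Ur erefl.
  rewrite smfunME smfunNE smfun_natE // (ricE t) //.
  exact: cvg_unique f2 f1.
move=> gbar at_xy latin greek G Ginv Ric Ric1 D0.
have m2_gt0 : (0 < m2)%N by exact: ltnW.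
have gam_pos a z : U z -> 0 < gam a a z.
  by move=> Uz; rewrite gamE //; exact: posdef_diag (gam_pd z Uz).
(* An identity between values of elements of the ring; what remains is to recognise each of them as
   the geometric quantity of the statement. *)
have evo := ricci_evolution_at wd einst gam_static m2_gt0 gam_pos flow alpha beta Uz0 erefl.
have der : has_derivative_within J
    (fun s => at_xy (ricci (gbar s)) (greek alpha) (greek beta)) t
    (time_der (fric (@space_der _ _ _ oU) (wmet g gam lam) (wmeti gi gami lami) hf
      (rshift m1 alpha) (rshift m1 beta)) (row_mx x y, t)).
  by apply: time_der_within => // s Js Us; exact: ricE s (row_mx x y, s) _ _ Js Us erefl.
have GinvE a b : wmeti gi gami lami a b (row_mx x y, t) = Ginv a b.
  exact: represents_inv (fm_inv fm) (repW t Jt) a b _ Uz0 erefl.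
have RicE a b : fric (@space_der _ _ _ oU) (wmet g gam lam) (wmeti gi gami lami) hf a b
    (row_mx x y, t) = Ric a b.
  exact: ricE t (row_mx x y, t) a b Jt Uz0 erefl.
have GE a b : wmet g gam lam a b (row_mx x y, t) = G a b.
  exact: repW t Jt a b _ Uz0 erefl.
have Ric1E k p : fric (fun i => @space_der _ _ _ oU (lshift m2 i)) g gi hf k p (row_mx x y, t)
    = Ric1 k p.
  have fm1 := wd_fm1 wd.
  have rep_g i j : represents (fun z : V => lsubmx z.1) (S t) (g i j)
      (fun w => g1 t c1 w i j).
    by move=> w Uw Sw; rewrite gE // Sw.
  have bp_line h i (w : V) : lsubmx (h *: ((delta_mx 0 (lshift m2 i), 0) : V) + w).1
      = h *: delta_mx 0 i + lsubmx w.1.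
    by rewrite /= lsubmx_line.
  have -> := represents_ric (S := S t) bp_line (fun h i => S_line t h _) (fm_inv fm1)
    (fm_half fm1) rep_g k p Uz0 erefl.
  by rewrite /= row_mxKl.
have LapE a b : flaplacian (@space_der _ _ _ oU) (wmet g gam lam) (wmeti gi gami lami) hf
    (fric (@space_der _ _ _ oU) (wmet g gam lam) (wmeti gi gami lami) hf) a b (row_mx x y, t)
    = at_xy (laplacian (gbar t) (ricci (gbar t))) a b.
  have H := represents_laplacian fst_line (S_line t) (fm_inv fm) (fm_half fm)
    (repW t Jt) (repRic t Jt) a b.
  exact: H _ Uz0 erefl.
move: der; rewrite evo LapE RicE GE.
under eq_bigr do under eq_bigr do rewrite GinvE RicE Ric1E.
under [in X in _ + X]eq_bigr do under eq_bigr do under eq_bigr do under eq_bigr do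
  rewrite !GinvE !RicE Ric1E.
exact.
Qed.
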